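(* Let $p$ be a prime and let $G$ be a group with a presentation $\langle X|R\rangle$, $X$ finite, such that either $R$ is finite and $\mathrm{def}_p(G;X,R)>1$, or $R$ is infinite and $\mathrm{def}_p(G;X,R)\geq 1$. Then $G$ does not have property (T).
   Context: For a presentation $\langle X|R\rangle$ of $G$ with $X$ finite and $R$ a subset (finite or infinite) of the free group $F(X)$, the $p$-deficiency is $\mathrm{def}_p(G;X,R)=|X|-\sum_{r\in R}p^{-\nu_p(r)}$, where $\nu_p(r)=\max\{k\ge 0 : \exists w\in F(X),\ w^{p^k}=r\}$; if $R$ is infinite and the sum does not converge, then $\mathrm{def}_p(G;X,R)=-\infty$. A finitely generated group has property (T) if every isometric action of it on a Hilbert space has a global fixed point. *)

(* Defs.v *)
From HB Require Import structures.
From mathcomp Require Import all_boot all_order all_algebra.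
From mathcomp Require Import sesquilinear.
From mathcomp Require Import boolp classical_sets functions cardinality.
From mathcomp Require Import reals ereal topology normedtype esum.

Set Implicit Arguments.
Unset Strict Implicit.
Unset Printing Implicit Defensive.

Import Order.TTheory GRing.Theory Num.Theory.
Import numFieldNormedType.Exports.

Local Open Scope classical_set_scope.
Local Open Scope group_scope.

(* The free group on X is the set of reduced words in the letters (x, true),  *)
(* standing for x, and (x, false), standing for x^-1.                         *)
Section FreeGroup.
Variable X : choiceType.
Implicit Types (a b : X * bool) (s t u : seq (X * bool)).

Definition inv_letter a : X * bool := (a.1, ~~ a.2).

Definition reduced s := sorted (fun a b => b != inv_letter a) s.

(* the reduced form of a :: s, when s is reduced *)
Definition push a s :=
  if s is b :: s' then (if b == inv_letter a then s' else a :: s) else [:: a].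

Definition wmul s t := foldr push t s.
Definition winv s := rev (map inv_letter s).

Lemma inv_letterK : involutive inv_letter.
Proof. by case=> x b; rewrite /inv_letter /= negbK. Qed.

Lemma reduced_behead a s : reduced (a :: s) -> reduced s.
Proof. by rewrite /reduced /=; case: s => //= b s /andP[]. Qed.

Lemma push_reduced a s : reduced s -> reduced (push a s).
Proof.
case: s => //= b s; case: ifP => [_|/negbT ba] H; first exact: reduced_behead H.
by rewrite /reduced /= ba.
Qed.

Lemma push_cons a s : reduced (a :: s) -> push a s = a :: s.
Proof. by case: s => //= b s; rewrite /reduced /= => /andP[/negbTE ->]. Qed.

Lemma pushK a s : reduced s -> push a (push (inv_letter a) s) = s.
Proof.
case: s => [_|b s] /=; first by rewrite eqxx.
rewrite inv_letterK; have [-> H|ba H] := eqVneq b a; first exact: push_cons.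
by rewrite /= eqxx.
Qed.

Lemma wmul_reduced s t : reduced t -> reduced (wmul s t).
Proof. by move=> rt; elim: s => //= a s; apply: push_reduced. Qed.

Lemma wmul_push a s t : reduced s -> reduced t ->
  wmul (push a s) t = push a (wmul s t).
Proof.
case: s => //= b s rs rt; have [->|//] := eqVneq b (inv_letter a).
by rewrite pushK// wmul_reduced.
Qed.

Lemma wmulA s t u : reduced t -> reduced u ->
  wmul s (wmul t u) = wmul (wmul s t) u.
Proof.
move=> rt ru; elim: s => //= a s ->.
by rewrite wmul_push// wmul_reduced.
Qed.

Lemma wmuls0 s : reduced s -> wmul s [::] = s.
Proof.
elim: s => //= a s IH rs; rewrite IH ?push_cons//.
exact: reduced_behead rs.
Qed.

Lemma winvK : involutive winv.
Proof.
move=> s; rewrite /winv map_rev revK -map_comp -[RHS]map_id.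
by apply: eq_map => a /=; rewrite inv_letterK.
Qed.

Lemma winv_reduced s : reduced s -> reduced (winv s).
Proof.
rewrite /reduced /winv rev_sorted sorted_map; apply: sub_sorted => a b /=.
by rewrite inv_letterK; apply: contra => /eqP ->.
Qed.

Lemma wmulVK s t : reduced t -> wmul (winv s) (wmul s t) = t.
Proof.
elim: s t => //= a s IH t rt.
have := @pushK (inv_letter a) (wmul s t); rewrite inv_letterK => pK.
by rewrite /winv /= rev_cons /wmul foldr_rcons pK ?wmul_reduced//; apply: IH.
Qed.

Record free_group := FreeGroup { word : seq (X * bool); _ : reduced word }.

HB.instance Definition _ := [isSub for word].
HB.instance Definition _ := [Choice of free_group by <:].

Lemma wordP (g : free_group) : reduced (word g).
Proof. exact: (valP g). Qed.

Definition fg_one : free_group := @FreeGroup [::] isT.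
Definition fg_mul (g h : free_group) : free_group :=
  FreeGroup (wmul_reduced (word g) (wordP h)).
Definition fg_inv (g : free_group) : free_group :=
  FreeGroup (winv_reduced (wordP g)).

Lemma fg_mulA : associative fg_mul.
Proof. by move=> g h k; apply: val_inj; rewrite /= wmulA// wordP. Qed.

Lemma fg_mul1g : left_id fg_one fg_mul.
Proof. by move=> g; apply: val_inj. Qed.

Lemma fg_mulg1 : right_id fg_one fg_mul.
Proof. by move=> g; apply: val_inj; rewrite /= wmuls0// wordP. Qed.

Lemma fg_mulVg : left_inverse fg_one fg_inv fg_mul.
Proof.
move=> g; apply: val_inj => /=.
by rewrite -[X in wmul _ X]wmuls0 ?wordP// wmulVK.
Qed.

Lemma fg_mulgV : right_inverse fg_one fg_inv fg_mul.
Proof.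
move=> g; rewrite -(fg_mulVg (fg_inv g)); congr fg_mul.
by apply: val_inj; rewrite /= winvK.
Qed.

HB.instance Definition _ :=
  isGroup.Build free_group fg_mulA fg_mul1g fg_mulg1 fg_mulVg fg_mulgV.

Definition fg_gen (x : X) : free_group := @FreeGroup [:: (x, true)] isT.

Section Lift.
Variables (G : groupType) (f : X -> G).

Definition letter_val a : G := if a.2 then f a.1 else (f a.1)^-1.
Definition fg_lift (g : free_group) : G :=
  foldr (fun a y => letter_val a * y) 1 (word g).

Lemma fg_lift_mul : {morph fg_lift : g h / g * h}.
Proof.
have letter_valV a : letter_val (inv_letter a) = (letter_val a)^-1.
  by case: a => x []; rewrite /letter_val /= ?invgK.
move=> [s rs] [t rt]; rewrite /fg_lift /= {rs}.
elim: s => [|a s IH] /=; first by rewrite mul1g.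
rewrite -mulgA -IH; case: (wmul s t) => //= b u.
by case: eqP => // ->; rewrite /= letter_valV mulVKg.
Qed.

HB.instance Definition _ :=
  isMultiplicative.Build free_group G fg_lift fg_lift_mul.

Lemma fg_lift_gen x : fg_lift (fg_gen x) = f x.
Proof. by rewrite /fg_lift /= /letter_val /= mulg1. Qed.

Lemma fg_lift_unique (h : {multiplicative free_group -> G}) :
  (forall x, h (fg_gen x) = f x) -> h =1 fg_lift.
Proof.
move=> hf; have h1 : h 1 = 1 by apply: (mulgI (h 1)); rewrite -gmulfM !mulg1.
have hV g : h g^-1 = (h g)^-1.
  by apply: (mulgI (h g)); rewrite -gmulfM !mulgV.
case=> s; elim: s => [|a s IH] rs.
  by transitivity (h 1); [congr (h _); apply: val_inj|exact: h1].
have ra : reduced [:: a] by [].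
have -> : FreeGroup rs = FreeGroup ra * FreeGroup (reduced_behead rs).
  by apply: val_inj; rewrite /= push_cons.
rewrite gmulfM fg_lift_mul IH; congr (_ * _).
rewrite /fg_lift /= mulg1 /letter_val; case: a {rs} ra => x [] /= ra.
  by rewrite -hf; congr (h _); apply: val_inj.
by rewrite -hf -hV; congr (h _); apply: val_inj.
Qed.

End Lift.
End FreeGroup.

Definition normal_subgroup (F : groupType) (N : set F) :=
  [/\ N 1, (forall g h, N g -> N h -> N (g / h)) &
      forall g h, N g -> N (g ^ h)].

Definition normal_closure (F : groupType) (R : set F) : set F :=
  smallest (@normal_subgroup F) R.

(* <X | R> is a presentation of G *)
Definition is_presentation (X : finType) (R : set (free_group X))
    (G : groupType) :=
  exists phi : {multiplicative free_group X -> G},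
    (forall y, exists g, phi g = y) /\
    [set g | phi g = 1] = normal_closure R.

Definition is_nu (F : groupType) (p : nat) (r : F) (k : nat) :=
  (exists w : F, w ^+ (p ^ k)%N = r) /\
  (forall j, (exists w : F, w ^+ (p ^ j)%N = r) -> (j <= k)%N).

(* None stands for +oo: it is the value at r = 1, which is a p^k-th power for *)
(* every k.                                                                   *)
Definition nu (F : groupType) (p : nat) (r : F) : option nat :=
  xget None [set Some k | k in is_nu p r].

Definition relator_weight (K : realType) (F : groupType) (p : nat) (r : F) : K :=
  if nu p r is Some k then (p%:R ^- k)%R else 0%R.

(* The sum of nonnegative terms is +oo when it diverges, which gives the      *)
(* value -oo.                                                                 *)
Definition p_deficiency (K : realType) (p : nat) (X : finType)
    (R : set (free_group X)) : \bar K :=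
  (#|X|%:R%:E - esum R (fun r => (relator_weight K p r)%:E))%E.

Definition isometric_action (K : realType) (G : groupType)
    (H : normedModType K) (act : G -> H -> H) :=
  [/\ (forall x, act 1 x = x),
      (forall g h x, act (g * h) x = act g (act h x)) &
      (forall g x y, `|act g x - act g y| = `|x - y|)%R].

(* Hilbert spaces are real: K is the field of real numbers. Isometries are    *)
(* not assumed affine, so a complex Hilbert space is covered through its      *)
(* underlying real one, which has the same metric.                            *)
Definition property_T (K : realType) (G : groupType) :=
  forall (H : completeNormedModType K) (dot : {dot H for idfun}%R),
    (forall x, `|x| ^+ 2 = dot x x)%R ->
  forall act : G -> H -> H, isometric_action act ->
  exists x, forall g, act g x = x.

(* Main.v *)
(** Let [F] be free on [X]. The goal is a real function [k] on [G * G] which is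
    the Gram kernel [<b g, b h>] of an affine isometric action [g v = pi g v +
    b g] whose cocycle [b] is nonzero and harmonic, i.e. orthogonal to all
    coboundaries [v - pi g v]; harmonicity passes to pointwise limits of such
    kernels and excludes a fixed point of the action of [G] on the Hilbert
    space reproduced by [k].

    Finitely many relators [r = w ^+ (p ^ m)] with [1 + sum p ^- m < #|X|] are
    killed by a harmonic cocycle with values in the functions on a finite
    quotient [P] of [F / <<r>>], chosen so that the orders of the roots [w] in
    [P] are as large as possible among finite quotients. Harmonicity costs
    [#|P|] linear equations, and [b r = 0] costs [#|P| / p ^ m] equations if [w]
    has order [p ^ m] in [P]; as there are [#|X| #|P|] unknowns, a nonzero
    integral solution [b] of these equations exists. It kills the other
    relators as well: there, [w] has order [p ^ j] with [j < m], and [b r] is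
    [p ^ (m - j)] times [b (w ^+ (p ^ j))]. If all these latter values are
    divisible by [p ^ t], then [b] kills all relators modulo [p ^ t.+1], so that
    extending [P] by [b] modulo [p ^ t.+1] gives a finite quotient, in which [w]
    still has order [p ^ j]; hence the values are divisible by [p ^ t.+1].

    When [R] is infinite, every finite subset of [R] leaves out a relator of
    positive weight, so its total weight is less than [#|X| - 1] and the above
    applies; compactness gives a kernel for all of [R]. *)

Require Import Defs.
From HB Require Import structures.
From mathcomp Require Import all_boot all_order all_algebra.
From mathcomp Require Import all_fingroup cyclic.
From mathcomp Require Import sesquilinear.
From mathcomp Require Import boolp classical_sets functions cardinality fsbigop.
From mathcomp Require Import reals ereal topology normedtype esum.
From mathcomp Require Import ring lra.

Set Implicit Arguments.
Unset Strict Implicit.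
Unset Printing Implicit Defensive.

Import Order.TTheory GRing.Theory Num.Theory.
Import numFieldNormedType.Exports.

Local Open Scope classical_set_scope.

(** * Jordan-von Neumann: inner products from the parallelogram law *)

Section JordanVonNeumann.
Local Open Scope ring_scope.
Variables (K : realType) (V : lmodType K) (N : V -> K).
Hypothesis N_ge0 : forall u, 0 <= N u.
Hypothesis NZ : forall c u, N (c *: u) = c ^+ 2 * N u.
Hypothesis parallelogram : forall u v, N (u + v) + N (u - v) = (N u + N v) *+ 2.

Definition polar u v := (N (u + v) - N (u - v)) / 4%:R.

Let NN u : N (- u) = N u.
Proof. by rewrite -scaleN1r NZ sqrrN expr1n mul1r. Qed.

Let N0 : N 0 = 0.
Proof. by rewrite -(scale0r 0) NZ expr0n mul0r. Qed.

Lemma polar_diag u : polar u u = N u.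
Proof.
by rewrite /polar subrr N0 subr0 -mulr2n -scaler_nat NZ; field.
Qed.

Lemma polarC u v : polar u v = polar v u.
Proof. by rewrite /polar [u + v]addrC -(opprB v u) NN. Qed.

(** In the alternating sum of the parallelogram laws for [(u + w, v)], [(u - w, v)], [(v + w, u)]
    and [(v - w, u)], the unwanted terms cancel because [N] is even. *)
Lemma polarDl u v w : polar (u + v) w = polar u w + polar v w.
Proof.
have P1 := parallelogram (u + w) v; have P2 := parallelogram (u - w) v.
have P3 := parallelogram (v + w) u; have P4 := parallelogram (v - w) u.
have E1 : v + w - u = - (u - w - v) by rewrite !opprB addrA addrC addrA.
have E2 : v - w - u = - (u + w - v).
  by rewrite opprB opprD addrA -[in RHS]addrA [- u - w]addrC addrA.
have E3 x : v + x + u = u + x + v by rewrite addrAC [v + u]addrC addrAC.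
rewrite E1 NN E3 in P3; rewrite E2 NN E3 in P4.
rewrite /polar [u + v + w]addrAC [u + v - w]addrAC.
by move: P1 P2 P3 P4; rewrite !mulr2n; lra.
Qed.

Let polar0l w : polar 0 w = 0.
Proof. by have := polarDl 0 0 w; rewrite addr0; lra. Qed.

Let polarMn n u v : polar (u *+ n) v = n%:R * polar u v.
Proof.
elim: n => [|n IH]; first by rewrite mulr0n polar0l mul0r.
by rewrite mulrS polarDl IH -natr1; ring.
Qed.

Let polarNl u v : polar (- u) v = - polar u v.
Proof. by have := polarDl u (- u) v; rewrite subrr polar0l; lra. Qed.

Let polarMz (z : int) u v : polar (u *~ z) v = z%:~R * polar u v.
Proof.
by case: z => n; rewrite ?NegzE ?mulrNz -?pmulrn ?polarNl polarMn ?mulNr.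
Qed.

Let polar_bound u v : `|polar u v| <= N u + N v.
Proof.
have P := parallelogram u v; have := N_ge0 (u + v); have := N_ge0 (u - v).
by move: P; rewrite mulr2n /polar ler_norml => P *; apply/andP; split; lra.
Qed.

Let normsqD u v : N (u + v) = N u + polar u v *+ 2 + N v.
Proof.
by have := parallelogram u v; rewrite /polar !mulr2n; lra.
Qed.

(* [c |-> polar (c u) v - c (polar u v)] is additive and vanishes at 1, hence *)
(* is periodic, hence bounded, hence zero.                                    *)
Lemma polarZl c u v : polar (c *: u) v = c * polar u v.
Proof.
pose phi c := polar (c *: u) v - c * polar u v.
have phiB a b : phi (a - b) = phi a - phi b.
  by rewrite /phi scalerBl polarDl polarNl; ring.
have phi_int (z : int) : phi z%:~R = 0.
  by rewrite /phi scaler_int polarMz subrr.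
have phi_bound a : `|phi a| <= N u *+ 2 + N v *+ 2.
  have -> : phi a = phi (a - (Num.floor a)%:~R) by rewrite phiB phi_int subr0.
  have /andP[a0 a1] : 0 <= a - (Num.floor a)%:~R <= 1.
    by have := floor_le a; have := floorD1_gt a; rewrite intrD; lra.
  set b := a - _ in a0 a1 *; rewrite (le_trans (ler_normB _ _))//.
  rewrite [`|b * _|]normrM (ger0_norm a0).
  have b1 := polar_bound (b *: u) v; have b2 := polar_bound u v.
  have : b * `|polar u v| <= N u + N v.
    by apply: le_trans b2; rewrite ler_piMl.
  have : N (b *: u) <= N u by rewrite NZ ler_piMl// expr_le1.
  by rewrite !mulr2n; lra.
have phiMn a n : phi (a *+ n) = n%:R * phi a.
  by rewrite /phi -scalerMnl polarMn -mulr_natl; ring.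
apply/eqP; rewrite -subr_eq0 -/(phi c) -normr_eq0 eq_le normr_ge0 andbT.
rewrite leNgt; apply/negP => c0.
set C := _ + _ in phi_bound.
have := truncnS_gt (C / `|phi c|).
rewrite ltr_pdivrMr// => CM; have := phi_bound (c *+ (Num.truncn (C / `|phi c|)).+1).
by rewrite phiMn normrM ger0_norm// leNgt CM.
Qed.

Lemma polar_CauchySchwarz u v : polar u v ^+ 2 <= N u * N v.
Proof.
have pos t : 0 <= N u + t *+ 2 * polar u v + t ^+ 2 * N v.
  have := N_ge0 (u + t *: v); rewrite normsqD NZ polarC polarZl polarC.
  by rewrite mulrnAl.
have [v0|v0] := eqVneq (N v) 0.
  have [->|p0] := eqVneq (polar u v) 0; first by rewrite expr0n v0 mulr0.
  (* With [N v = 0] the polynomial is affine in [t]; here it takes the value [- N u - 2]. *)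
  have := pos (- (N u + 1) / polar u v); have := N_ge0 u.
  have -> : (- (N u + 1) / polar u v) *+ 2 * polar u v = - (N u + 1) *+ 2.
    by rewrite !mulr2n; field.
  by rewrite v0 mulr0 mulr2n; lra.
have vp : 0 < N v by rewrite lt_neqAle eq_sym v0 N_ge0.
(* This [t] minimizes the quadratic polynomial. *)
have := pos (- polar u v / N v).
have -> : N u + (- polar u v / N v) *+ 2 * polar u v + (- polar u v / N v) ^+ 2 * N v
   = (N u * N v - polar u v ^+ 2) / N v by rewrite !mulr2n; field.
by rewrite pmulr_lge0 ?invr_gt0// subr_ge0.
Qed.

Lemma sqrt_polar_triangle u v :
  Num.sqrt (N (u + v)) <= Num.sqrt (N u) + Num.sqrt (N v).
Proof.
rewrite -(@ler_pXn2r _ 2%N)// ?nnegrE ?addr_ge0 ?sqrtr_ge0// sqr_sqrtr//.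
rewrite sqrrD !sqr_sqrtr// -sqrtrM//.
rewrite normsqD lerD2r lerD2l lerMn2r/= (le_trans (ler_norm _))// -sqrtr_sqr.
by rewrite ler_wsqrtr// polar_CauchySchwarz.
Qed.

End JordanVonNeumann.

(** * Reproducing kernel Hilbert spaces *)

Section ReproducingKernel.
Local Open Scope ring_scope.
Variables (K : realType) (T : Type) (k : T -> T -> K).
Implicit Types (s t : seq (K * T)) (f g u v : T -> K).

(* A list of weighted points of [T] stands for a formal linear combination. *)
Definition comb_eval f s := \sum_(x <- s) x.1 * f x.2.
Definition comb_form s t :=
  \sum_(x <- s) \sum_(y <- t) x.1 * y.1 * k x.2 y.2.
Definition comb_scale (a : K) s := [seq (a * x.1, x.2) | x <- s].

Lemma comb_eval_cat f s t : comb_eval f (s ++ t) = comb_eval f s + comb_eval f t.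
Proof. by rewrite /comb_eval big_cat. Qed.

Lemma comb_eval_scale f a s : comb_eval f (comb_scale a s) = a * comb_eval f s.
Proof.
by rewrite /comb_eval big_map mulr_sumr; apply: eq_bigr => x _; rewrite mulrA.
Qed.

Lemma comb_evalD f g s : comb_eval (f + g) s = comb_eval f s + comb_eval g s.
Proof. by rewrite /comb_eval -big_split; apply: eq_bigr => x _; rewrite mulrDr. Qed.

Lemma comb_evalZ a f s : comb_eval (a *: f) s = a * comb_eval f s.
Proof.
rewrite /comb_eval mulr_sumr; apply: eq_bigr => x _.
by rewrite mulrCA.
Qed.

Lemma comb_evalB f g s : comb_eval (f - g) s = comb_eval f s - comb_eval g s.
Proof. by rewrite comb_evalD -[- g]scaleN1r comb_evalZ mulN1r. Qed.

Lemma comb_form_catl s s' t :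
  comb_form (s ++ s') t = comb_form s t + comb_form s' t.
Proof. by rewrite /comb_form big_cat. Qed.

Lemma comb_form_catr s t t' :
  comb_form s (t ++ t') = comb_form s t + comb_form s t'.
Proof. by rewrite /comb_form -big_split; apply: eq_bigr => x _; rewrite big_cat. Qed.

Lemma comb_form_scalel a s t : comb_form (comb_scale a s) t = a * comb_form s t.
Proof.
rewrite /comb_form big_map mulr_sumr; apply: eq_bigr => x _.
by rewrite mulr_sumr; apply: eq_bigr => y _; rewrite !mulrA.
Qed.

Lemma comb_form_scaler a s t : comb_form s (comb_scale a t) = a * comb_form s t.
Proof.
rewrite /comb_form mulr_sumr; apply: eq_bigr => x _.
by rewrite big_map mulr_sumr; apply: eq_bigr => y _ /=; ring.
Qed.

(* The supremum of [legendre f] over all combinations is the square of the    *)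
(* norm of [f] in the dual of the pre-Hilbert space of combinations.          *)
Definition legendre f s := comb_eval f s *+ 2 - comb_form s s.
Definition in_rkhs f := exists C, forall s, legendre f s <= C.
Definition rkhs_sqnorm f := sup (range (legendre f)).

Lemma legendre_nil f : legendre f [::] = 0.
Proof. by rewrite /legendre /comb_eval /comb_form !big_nil mul0rn subr0. Qed.

Lemma legendre_le_sqnorm f s : in_rkhs f -> legendre f s <= rkhs_sqnorm f.
Proof.
move=> [C fC]; apply: ub_le_sup; last by exists s.
by exists C => _ [t _ <-].
Qed.

Lemma sqnorm_le f C : (forall s, legendre f s <= C) -> rkhs_sqnorm f <= C.
Proof.
move=> fC; apply: ge_sup => [|_ [t _ <-]//].
by exists (legendre f [::]), [::].
Qed.

Lemma sqnorm_ge0 f : in_rkhs f -> 0 <= rkhs_sqnorm f.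
Proof. by move=> /(legendre_le_sqnorm [::]); rewrite legendre_nil. Qed.

(** Along the multiples of a null vector [s], [legendre f] is linear, so it is bounded only if it
    vanishes. *)
Lemma comb_eval_eq0 f s : in_rkhs f -> comb_form s s = 0 -> comb_eval f s = 0.
Proof.
move=> [C fC] s0; apply/eqP/negPn/negP => fs0.
have := fC (comb_scale ((C + 1) / comb_eval f s) s).
rewrite /legendre comb_form_scalel comb_form_scaler s0 comb_eval_scale divfK//.
have := fC [::]; rewrite legendre_nil mulr2n; lra.
Qed.

Lemma legendreZ a f s : a != 0 ->
  legendre (a *: f) s = a ^+ 2 * legendre f (comb_scale a^-1 s).
Proof.
move=> a0; rewrite /legendre comb_evalZ comb_eval_scale.
by rewrite comb_form_scalel comb_form_scaler !mulr2n; field.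
Qed.

Lemma legendreD f g s : legendre (f + g) s =
  (legendre f (comb_scale 2^-1 s) + legendre g (comb_scale 2^-1 s)) *+ 2.
Proof.
rewrite /legendre comb_evalD !comb_eval_scale !comb_form_scalel.
by rewrite !comb_form_scaler; lra.
Qed.

(** As [s] and [t] are independent, passing to suprema yields one inequality of the parallelogram
    law. *)
Lemma legendre_parallelogram f g s t :
  legendre (f + g) s + legendre (f - g) t =
  (legendre f (comb_scale 2^-1 (s ++ t)) +
   legendre g (comb_scale 2^-1 (s ++ comb_scale (-1) t))) *+ 2.
Proof.
rewrite /legendre comb_evalD comb_evalB.
do 4!rewrite ?(comb_eval_scale, comb_eval_cat, comb_form_scalel, comb_form_scaler,
  comb_form_catl, comb_form_catr).
by lra.
Qed.

Hypothesis comb_form_ge0 : forall s, 0 <= comb_form s s.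

Lemma in_rkhs0 : in_rkhs 0.
Proof.
exists 0 => s; rewrite /legendre.
have -> : comb_eval 0 s = 0 by rewrite -(scale0r 0) comb_evalZ mul0r.
by rewrite mul0rn sub0r oppr_le0.
Qed.

Lemma in_rkhsZ a f : in_rkhs f -> in_rkhs (a *: f).
Proof.
have [-> _|a0 [C fC]] := eqVneq a 0; first by rewrite scale0r; exact: in_rkhs0.
by exists (a ^+ 2 * C) => s; rewrite legendreZ// ler_pM2l ?exprn_even_gt0.
Qed.

Lemma in_rkhsD f g : in_rkhs f -> in_rkhs g -> in_rkhs (f + g).
Proof.
move=> [C fC] [D gD]; exists ((C + D) *+ 2) => s.
by rewrite legendreD lerMn2r/= lerD.
Qed.

Lemma in_rkhsB f g : in_rkhs f -> in_rkhs g -> in_rkhs (f - g).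
Proof.
by move=> fH gH; apply: in_rkhsD => //; rewrite -scaleN1r; apply: in_rkhsZ.
Qed.

Lemma sqnormZ a f : in_rkhs f -> rkhs_sqnorm (a *: f) = a ^+ 2 * rkhs_sqnorm f.
Proof.
have sqnormZ_le b g : b != 0 -> in_rkhs g ->
    rkhs_sqnorm (b *: g) <= b ^+ 2 * rkhs_sqnorm g.
  move=> b0 gH; apply: sqnorm_le => s.
  by rewrite legendreZ// ler_pM2l ?exprn_even_gt0//; apply: legendre_le_sqnorm.
have [-> _|a0 fH] := eqVneq a 0.
  rewrite scale0r expr0n mul0r; apply/eqP.
  rewrite eq_le sqnorm_ge0 ?andbT; last exact: in_rkhs0.
  apply: sqnorm_le => s; rewrite /legendre -(scale0r 0) comb_evalZ mul0r mul0rn.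
  by rewrite sub0r oppr_le0.
apply/eqP; rewrite eq_le sqnormZ_le//=.
have := sqnormZ_le a^-1 (a *: f); rewrite scalerK// invr_eq0 exprVn.
rewrite mulrC ler_pdivlMr ?exprn_even_gt0// mulrC; apply => //.
exact: in_rkhsZ.
Qed.

Lemma sqnorm_parallelogram f g : in_rkhs f -> in_rkhs g ->
  rkhs_sqnorm (f + g) + rkhs_sqnorm (f - g) =
  (rkhs_sqnorm f + rkhs_sqnorm g) *+ 2.
Proof.
have half u v : in_rkhs u -> in_rkhs v -> rkhs_sqnorm (u + v) +
    rkhs_sqnorm (u - v) <= (rkhs_sqnorm u + rkhs_sqnorm v) *+ 2.
  move=> uH vH; rewrite -lerBrDr; apply: sqnorm_le => s.
  rewrite lerBrDr -lerBrDl; apply: sqnorm_le => t; rewrite lerBrDl.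
  by rewrite legendre_parallelogram lerMn2r/= lerD// legendre_le_sqnorm.
move=> fH gH; apply/eqP; rewrite eq_le half//=.
(* The reverse inequality is [half] for [f + g] and [f - g], whose sum and difference are [2 *: f]
   and [2 *: g]. *)
have := half (f + g) (f - g) (in_rkhsD fH gH) (in_rkhsB fH gH).
have -> : f + g + (f - g) = 2 *: f.
  apply/funext => x; rewrite -[LHS]/(f x + g x + (f x - g x)).
  by rewrite -[RHS]/(2 * f x); ring.
have -> : f + g - (f - g) = 2 *: g.
  apply/funext => x; rewrite -[LHS]/(f x + g x - (f x - g x)).
  by rewrite -[RHS]/(2 * g x); ring.
by rewrite !sqnormZ//; lra.
Qed.

Lemma comb_eval_CauchySchwarz f s : in_rkhs f ->
  comb_eval f s ^+ 2 <= rkhs_sqnorm f * comb_form s s.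
Proof.
move=> fH; have [q0|q0] := eqVneq (comb_form s s) 0.
  by rewrite comb_eval_eq0// expr0n q0 mulr0.
have qp : 0 < comb_form s s by rewrite lt_neqAle eq_sym q0 comb_form_ge0.
rewrite -ler_pdivrMr//.
(* Among the multiples of [s], this one maximizes [legendre f]. *)
apply: le_trans (legendre_le_sqnorm (comb_scale (comb_eval f s / comb_form s s) s) fH).
rewrite /legendre comb_eval_scale comb_form_scalel comb_form_scaler divfK//.
by rewrite mulr2n addrK expr2 mulrAC.
Qed.

Lemma eval_CauchySchwarz f x : in_rkhs f ->
  f x ^+ 2 <= rkhs_sqnorm f * k x x.
Proof.
move=> /(comb_eval_CauchySchwarz [:: (1, x)]).
by rewrite /comb_eval /comb_form !big_seq1 !mul1r.
Qed.

Lemma sqnorm_eq0 f : in_rkhs f -> rkhs_sqnorm f = 0 -> f = 0.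
Proof.
move=> fH f0; apply/funext => x; apply/eqP.
by rewrite -sqrf_eq0 eq_le sqr_ge0 (le_trans (eval_CauchySchwarz x fH))// f0 mul0r.
Qed.

End ReproducingKernel.

Record psd_kernel (K : realType) (T : Type) := PsdKernel {
  kernel_fun :> T -> T -> K;
  kernel_psd : forall s, (0 <= comb_form kernel_fun s s)%R
}.

(** * The Hilbert space of a positive semidefinite kernel *)

Section RkhsType.
Local Open Scope ring_scope.
Variables (K : realType) (T : Type) (k : psd_kernel K T).

Definition rkhs_pred : {pred T -> K} := fun f => `[< in_rkhs k f >].

Lemma rkhs_predP f : reflect (in_rkhs k f) (f \in rkhs_pred).
Proof. exact: asboolP. Qed.

Lemma rkhs_submod_closed : submod_closed rkhs_pred.
Proof.
split; first by apply/rkhs_predP/in_rkhs0/kernel_psd.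
move=> a f g /rkhs_predP fH /rkhs_predP gH; apply/rkhs_predP.
by apply: in_rkhsD => //; apply: in_rkhsZ => //; apply: kernel_psd.
Qed.

HB.instance Definition _ :=
  GRing.isSubmodClosed.Build K (T -> K) rkhs_pred rkhs_submod_closed.

Record rkhs := Rkhs { rkhs_fun :> T -> K; _ : rkhs_fun \in rkhs_pred }.

HB.instance Definition _ := [isSub for rkhs_fun].
HB.instance Definition _ := [Choice of rkhs by <:].
HB.instance Definition _ := [SubChoice_isSubLmodule of rkhs by <:].

Lemma rkhsP (f : rkhs) : in_rkhs k f.
Proof. exact/rkhs_predP/(valP f). Qed.

Lemma rkhs_ext (f g : rkhs) : f =1 g -> f = g.
Proof. by move=> fg; apply/val_inj/funext. Qed.

Definition sqnorm (f : rkhs) := rkhs_sqnorm k f.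

Let sqnormZ' a (f : rkhs) : sqnorm (a *: f) = a ^+ 2 * sqnorm f.
Proof. exact: (sqnormZ (@kernel_psd _ _ k) a (rkhsP f)). Qed.

Let sqnormP (f g : rkhs) :
  sqnorm (f + g) + sqnorm (f - g) = (sqnorm f + sqnorm g) *+ 2.
Proof. exact: (sqnorm_parallelogram (@kernel_psd _ _ k) (rkhsP f) (rkhsP g)). Qed.

Let sqnorm_pos (f : rkhs) : 0 <= sqnorm f.
Proof. exact: sqnorm_ge0 (rkhsP f). Qed.

Let sqnorm_eq0 (f : rkhs) : sqnorm f = 0 -> f = 0.
Proof. by move=> f0; apply/val_inj/(sqnorm_eq0 (@kernel_psd _ _ k) (rkhsP f)). Qed.

Definition rkhs_dot : rkhs -> rkhs -> K := polar sqnorm.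

Lemma rkhs_dot_bilinear : bilinear_for *%R (idfun \; *%R) rkhs_dot.
Proof.
split=> u a v w; rewrite /rkhs_dot.
  by rewrite polarDl ?polarZl.
by rewrite !(polarC sqnormZ' u) polarDl ?polarZl.
Qed.

HB.instance Definition _ := bilinear_isBilinear.Build K rkhs rkhs K *%R
  (idfun \; *%R) rkhs_dot rkhs_dot_bilinear.

Lemma rkhs_dot_sym (f g : rkhs) :
  rkhs_dot f g = (-1) ^+ false * idfun (rkhs_dot g f).
Proof. by rewrite /= expr0 mul1r; apply: polarC. Qed.

HB.instance Definition _ := isHermitianSesquilinear.Build K rkhs false idfun
  rkhs_dot rkhs_dot_sym.

Lemma rkhs_dot_gt0 (f : rkhs) : f != 0 -> 0 < rkhs_dot f f.
Proof.
rewrite /rkhs_dot polar_diag// => f0; rewrite lt_neqAle sqnorm_pos andbT eq_sym.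
by apply: contra f0 => /eqP/sqnorm_eq0 ->.
Qed.

HB.instance Definition _ := isDotProduct.Build K rkhs rkhs_dot rkhs_dot_gt0.

Definition rkhs_norm (f : rkhs) := Num.sqrt (sqnorm f).

Lemma rkhs_normD (f g : rkhs) : rkhs_norm (f + g) <= rkhs_norm f + rkhs_norm g.
Proof. exact: sqrt_polar_triangle. Qed.

Lemma rkhs_normZ a (f : rkhs) : rkhs_norm (a *: f) = `|a| * rkhs_norm f.
Proof. by rewrite /rkhs_norm sqnormZ' sqrtrM ?sqr_ge0// sqrtr_sqr. Qed.

Lemma rkhs_norm_eq0 (f : rkhs) : rkhs_norm f = 0 -> f = 0.
Proof.
move/eqP; rewrite sqrtr_eq0 => f0; apply: sqnorm_eq0.
by apply/eqP; rewrite eq_le f0 sqnorm_pos.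
Qed.

HB.instance Definition _ := Lmodule_isNormed.Build K rkhs
  rkhs_normD rkhs_normZ rkhs_norm_eq0.

Lemma rkhs_sqrnorm (f : rkhs) : `|f| ^+ 2 = sqnorm f.
Proof. by rewrite sqr_sqrtr. Qed.

Lemma rkhs_dot_norm (f : rkhs) : `|f| ^+ 2 = rkhs_dot f f.
Proof. by rewrite rkhs_sqrnorm /rkhs_dot polar_diag. Qed.

Lemma rkhs_eval_le (f : rkhs) x : `|f x| <= `|f| * Num.sqrt (k x x).
Proof.
have kxx : 0 <= k x x.
  by have := kernel_psd k [:: (1, x)]; rewrite /comb_form !big_seq1 !mul1r.
rewrite -(@ler_pXn2r _ 2%N)// ?nnegrE ?mulr_ge0 ?sqrtr_ge0//.
rewrite real_normK ?num_real// exprMn rkhs_sqrnorm sqr_sqrtr//.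
exact: (eval_CauchySchwarz (@kernel_psd _ _ k) x (rkhsP f)).
Qed.

(** Evaluations are continuous, so a Cauchy filter has a pointwise limit [L]; bounds on [legendre]
    pass to [L] and give both membership and convergence in norm. *)
Lemma rkhs_complete (F : set_system rkhs) :
  ProperFilter F -> cauchy F -> cvg F.
Proof.
move=> FF /cauchyP Fc.
have FLex x : exists l : K, (f : rkhs) x @[f --> F] --> l.
  apply/cvg_ex/cauchy_cvgP/cauchyP => e e0.
  (* The summand 1 keeps the divisor positive when [k x x = 0]. *)
  have c0 : 0 < Num.sqrt (k x x) + 1 by rewrite ltr_wpDl// sqrtr_ge0.
  have [f0 Ff0] := Fc _ (divr_gt0 e0 c0).
  exists (f0 x); apply: (@filterS _ F _ _ _ _ Ff0) => f.
  rewrite -!ball_normE/= ltr_pdivlMr// => /le_lt_trans; apply.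
  apply: (le_trans (rkhs_eval_le (f0 - f) x)).
  by rewrite ler_wpM2l// lerDl.
have [L FL] := choice FLex.
have FLs s : (comb_eval f s @[f --> F]) --> comb_eval L s.
  rewrite /comb_eval; elim: s => [|y s IH].
    by under eq_fun do rewrite big_nil; rewrite big_nil; apply: cvg_cst.
  under eq_fun do rewrite big_cons; rewrite big_cons.
  by apply: cvgD => //; apply: cvgMl_tmp; apply: FL.
(* For fixed [s], [legendre] depends on finitely many values, so its bound survives the pointwise
   limit. *)
have FLf d (f0 : rkhs) s : F (ball f0 d) -> legendre k (L - f0) s <= d ^+ 2.
  move=> Ff0; rewrite /legendre comb_evalB mulr2n.
  have B : comb_eval (f : rkhs) s - comb_eval f0 s @[f --> F] -->
      comb_eval L s - comb_eval f0 s.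
    by apply: cvgB; [exact: FLs|exact: cvg_cst].
  apply: (cvgr_to_le (cvgB (cvgD B B) (cvg_cst _))).
  apply: (@filterS _ F _ _ _ _ Ff0) => f; rewrite -ball_normE/= distrC => ff0.
  rewrite [leLHS](_ : _ = legendre k (f - f0) s); last first.
    by rewrite /legendre mulr2n (comb_evalB f f0).
  apply: (le_trans (legendre_le_sqnorm s (rkhsP (f - f0)))).
  rewrite -/(sqnorm _) -rkhs_sqrnorm ler_sqr ?nnegrE//; first exact: ltW.
  by apply: ltW; apply: le_lt_trans ff0.
have LH : in_rkhs k L.
  have [f0 Ff0] := Fc 1 ltr01; rewrite -(subrK (f0 : T -> K) L).
  apply: in_rkhsD; last exact: rkhsP.
  by exists (1 ^+ 2) => s; apply: FLf.
apply/cvg_ex; exists (Rkhs (introT (rkhs_predP L) LH)).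
apply/cvgrPdist_le => e e0; have e2 : 0 < e / 2 by rewrite divr_gt0.
have [f0 Ff0] := Fc _ e2; apply: (@filterS _ F _ _ _ _ Ff0) => f.
rewrite -ball_normE/= => ff0; rewrite -(subrK f0 (Rkhs _)) -addrA (splitr e).
apply: (le_trans (ler_normD _ _)); apply: lerD; last exact: ltW.
rewrite -(@ler_pXn2r _ 2%N)// ?nnegrE//; last exact: ltW.
by rewrite rkhs_sqrnorm; apply: sqnorm_le => s; apply: FLf.
Qed.

HB.instance Definition _ := Uniform_isComplete.Build rkhs rkhs_complete.

Definition rkhs_hilbert : completeNormedModType K := rkhs.

End RkhsType.

(** * Affine actions from harmonic kernels *)

(* The kernel [(g, h) |-> <b g, b h>] of a 1-cocycle [b] of an orthogonal     *)
(* representation of [G] that is orthogonal to all coboundaries, normalized   *)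
(* on the family [s].                                                         *)
Record harmonic_kernel (K : realType) (X : finType) (G : groupType) (s : X -> G)
    (k : G -> G -> K) : Prop := HarmonicKernel {
  hk_psd : forall t, (0 <= comb_form k t t)%R;
  hk_sym : forall g h, k g h = k h g;
  hk_1 : forall h, k 1%g h = 0%R;
  hk_cocycle : forall g h h', (k (g * h)%g (g * h')%g - k (g * h)%g g -
    k g (g * h')%g + k g g)%R = k h h';
  hk_norm : (\sum_x k (s x) (s x))%R = 1%R;
  hk_harmonic : forall h, (\sum_x (k (s x) h + k (s x)^-1%g h))%R = 0%R
}.

Section HarmonicKernel.
Local Open Scope ring_scope.
Variables (K : realType) (G : groupType) (k : psd_kernel K G).
Hypothesis kC : forall g h, k g h = k h g.
Hypothesis k1 : forall h, k 1%g h = 0.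
Hypothesis k_cocycle : forall g h h',
  k (g * h)%g (g * h')%g - k (g * h)%g g - k g (g * h')%g + k g g = k h h'.

(** The linear part of the action: if [f h] is the inner product of [v] and [b h], then
    [translate g f h] is that of [pi g v] and [b h]. *)
Definition translate (g : G) (f : G -> K) (h : G) : K :=
  f (g^-1 * h)%g - f (g^-1)%g.

(** The adjoint of [translate g] sends the point [h] to [g^-1 * h] minus [g^-1]; by [k_cocycle] it
    preserves [comb_form]. *)
Lemma translate_sqnorm_le (f : rkhs k) g s :
  legendre k (translate g f) s <= sqnorm f.
Proof.
pose t : seq (K * G) := [seq (x.1, (g^-1 * x.2)%g) | x <- s] ++
  comb_scale (-1) [seq (x.1, (g^-1)%g) | x <- s].
have -> : legendre k (translate g f) s = legendre k f t.
  rewrite /legendre; congr (_ *+ 2 - _).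
    rewrite comb_eval_cat comb_eval_scale mulN1r /comb_eval !big_map -sumrB.
    by apply: eq_bigr => x _; rewrite /= -mulrBr.
  rewrite !(comb_form_catl, comb_form_catr).
  rewrite !(comb_form_scalel, comb_form_scaler) !mulN1r opprK.
  rewrite /comb_form !big_map -!sumrN -!big_split; apply: eq_bigr => x _ /=.
  rewrite !big_map -!sumrN -!big_split; apply: eq_bigr => y _ /=.
  by rewrite -(k_cocycle g^-1 x.2 y.2); ring.
exact/legendre_le_sqnorm/rkhsP.
Qed.

Lemma in_rkhs_translate (f : rkhs k) g : in_rkhs k (translate g f).
Proof. by exists (sqnorm f) => s; apply: translate_sqnorm_le. Qed.

(** Positivity of the form on [s] minus the point [g] bounds [legendre] by [k g g]. *)
Lemma in_rkhs_kernel g : in_rkhs k (k^~ g).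
Proof.
exists (k g g) => s; have := kernel_psd k (s ++ [:: (-1, g)]).
rewrite !(comb_form_catl, comb_form_catr).
have -> : comb_form k s [:: (-1, g)] = - comb_eval (k^~ g) s.
  rewrite /comb_form /comb_eval -sumrN; apply: eq_bigr => x _.
  by rewrite big_seq1 /=; ring.
have -> : comb_form k [:: (-1, g)] s = - comb_eval (k^~ g) s.
  rewrite /comb_form /comb_eval -sumrN big_seq1; apply: eq_bigr => x _.
  by rewrite kC /=; ring.
by rewrite /legendre /comb_form !big_seq1 mulr2n /=; lra.
Qed.

Lemma in_rkhs_act (f : rkhs k) g : in_rkhs k (translate g f + k^~ g).
Proof.
apply: in_rkhsD; [exact: in_rkhs_translate|exact: in_rkhs_kernel].
Qed.

(** The translation part [k^~ g] represents the vector [b g]. *)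
Definition kernel_act (g : G) (f : rkhs k) : rkhs k :=
  Rkhs (introT (rkhs_predP k _) (in_rkhs_act f g)).

Lemma kernel_actE g f x :
  kernel_act g f x = f (g^-1 * x)%g - f (g^-1)%g + k x g.
Proof. by []. Qed.

Lemma rkhs_at1 (f : rkhs k) : f 1%g = 0.
Proof.
apply/eqP; rewrite -normr_eq0 eq_le normr_ge0 andbT.
by rewrite (le_trans (rkhs_eval_le f 1%g))// k1 sqrtr0 mulr0.
Qed.

Lemma kernel_actM g h f : kernel_act (g * h)%g f = kernel_act g (kernel_act h f).
Proof.
apply: rkhs_ext => x; rewrite !kernel_actE !invgM !mulgA.
rewrite -(k_cocycle g (g^-1 * x)%g h) -(k_cocycle g (g^-1)%g h).
by rewrite !mulgA !mulgV !mul1g !k1; ring.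
Qed.

Lemma kernel_act1 f : kernel_act 1%g f = f.
Proof.
apply: rkhs_ext => x; rewrite kernel_actE invg1 mul1g rkhs_at1.
by rewrite kC k1 subr0 addr0.
Qed.

Lemma kernel_act_isometry g (f f' : rkhs k) :
  `|kernel_act g f - kernel_act g f'| = `|f - f'|.
Proof.
(* One inequality suffices, since it also applies to the inverse of [g]. *)
have le_dist h (u v : rkhs k) : `|kernel_act h u - kernel_act h v| <= `|u - v|.
  rewrite -(@ler_pXn2r _ 2%N)// ?nnegrE// !rkhs_sqrnorm.
  apply: sqnorm_le => s; apply: le_trans (translate_sqnorm_le _ h s).
  suff -> : rkhs_fun (kernel_act h u - kernel_act h v) = translate h (u - v).
    by [].
  apply/funext => x; rewrite -[LHS]/(kernel_act h u x - kernel_act h v x).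
  rewrite !kernel_actE.
  rewrite -[RHS]/((u (h^-1 * x)%g - v (h^-1 * x)%g) - (u h^-1%g - v h^-1%g)).
  by ring.
apply/eqP; rewrite eq_le le_dist/=.
have := le_dist (g^-1)%g (kernel_act g f) (kernel_act g f').
by rewrite -!kernel_actM mulVg !kernel_act1.
Qed.

(* A fixed point [z] satisfies [z s + z s^-1 = k s s]; by harmonicity the sum *)
(* over the generators of the left-hand sides vanishes.                       *)
Lemma harmonic_no_fixed_point (X : finType) (s : X -> G) :
  \sum_x k (s x) (s x) = 1 ->
  (forall h, \sum_x (k (s x) h + k (s x)^-1%g h) = 0) ->
  ~ property_T K G.
Proof.
move=> sum1 harm TG; have [z zfix] := TG (rkhs_hilbert k) (@rkhs_dot _ _ k)
  (@rkhs_dot_norm _ _ k) kernel_act (And3 kernel_act1 kernel_actM kernel_act_isometry).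
have zs x : z (s x) + z (s x)^-1%g = k (s x) (s x).
  have /(congr1 (fun f : rkhs k => f (s x))) := zfix (s x).
  by rewrite kernel_actE mulVg rkhs_at1 => <-; ring.
pose t := [seq (1 : K, s x) | x <- index_enum X] ++
  [seq (1 : K, (s x)^-1%g) | x <- index_enum X].
have form_t f : comb_eval f t = \sum_x (f (s x) + f (s x)^-1%g).
  rewrite comb_eval_cat /comb_eval !big_map -big_split.
  by apply: eq_bigr => x _ /=; rewrite !mul1r.
(* Harmonicity makes [t] a null vector, so all functions of the space, in particular [z], vanish on
   it. *)
have t0 : comb_form k t t = 0.
  rewrite /comb_form exchange_big big1_seq// => -[a h] /= _.
  transitivity (a * comb_eval (k^~ h) t).
    by rewrite mulr_sumr; apply: eq_bigr => x _; rewrite mulrA [a * _]mulrC.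
  by rewrite form_t harm mulr0.
have := comb_eval_eq0 (rkhsP z) t0; rewrite form_t (eq_bigr _ (fun x _ => zs x)) sum1.
by move/eqP; rewrite oner_eq0.
Qed.

End HarmonicKernel.

Lemma harmonic_kernel_not_T (K : realType) (X : finType) (G : groupType)
    (s : X -> G) (k : G -> G -> K) :
  harmonic_kernel s k -> ~ property_T K G.
Proof.
case=> psd sym k1 coc norm harm.
exact: (harmonic_no_fixed_point (k := PsdKernel psd) sym k1 coc norm harm).
Qed.

(** * Roots in free groups *)

Section FreeGroupRoots.
Variable X : choiceType.
Implicit Types (a b : X * bool) (s t u c : seq (X * bool)).

Lemma reduced_cat_cons s b t :
  reduced (s ++ b :: t) = reduced (rcons s b) && reduced (b :: t).
Proof.
rewrite /reduced; case: s => //= a s.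
by rewrite rcons_path cat_path /= andbA.
Qed.

Lemma reduced_glue s c t : c != [::] ->
  reduced (s ++ c) -> reduced (c ++ t) -> reduced (s ++ c ++ t).
Proof.
case: c => // b c _; rewrite cat_cons !reduced_cat_cons -cat_cons.
by move=> /andP[-> _] ->.
Qed.

Lemma reduced_catl s t : reduced (s ++ t) -> reduced s.
Proof. by move=> /cat_sorted2[]. Qed.

Lemma reduced_catr s t : reduced (s ++ t) -> reduced t.
Proof. by move=> /cat_sorted2[]. Qed.

Lemma wmul_cat_reduced s t : reduced (s ++ t) -> wmul s t = s ++ t.
Proof.
elim: s => //= a s IH rst; rewrite IH ?push_cons//.
exact: reduced_behead rst.
Qed.

Lemma wmul_catl s t u : wmul (s ++ t) u = wmul s (wmul t u).
Proof. by rewrite /wmul foldr_cat. Qed.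

(** Strip the first and the last letter as long as they cancel; a cyclically reduced word [c]
    remains. *)
Lemma cyclic_decomposition s : reduced s -> s != [::] ->
  exists u c, [/\ s = u ++ c ++ winv u, c != [::] & reduced (c ++ c)].
Proof.
have [n] := ubnP (size s); elim: n s => // n IH [//|a s] /= sn rs _.
have [la|la] := eqVneq (last a s) (inv_letter a); last first.
  exists [::], (a :: s); rewrite cats0; split=> //.
  rewrite cat_cons /reduced /= cat_path -/(reduced (a :: s)).
  rewrite /reduced /= in rs; rewrite rs /= rs andbT.
  by apply: contra la => /eqP E; apply/eqP; rewrite [in RHS]E inv_letterK.
case/lastP: s la sn rs => [/=|m b].
  by case: a => x [].
rewrite last_rcons size_rcons => -> mn rs.
have rm : reduced m.
  by move: rs => /reduced_behead; rewrite -cats1 => /reduced_catl.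
have m0 : m != [::].
  by apply: contraTneq rs => ->; rewrite /reduced /= eqxx.
have [u [c [-> c0 rc]]] := IH m (ltnW mn) rm m0.
exists (a :: u), c; split=> //.
by rewrite /winv /= rev_cons rcons_cat rcons_cat.
Qed.

(** For [w = u c u^-1] with [c] cyclically reduced, the word [u c ... c u^-1] with [n] copies of [c]
    is reduced. *)
Lemma leq_size_expg (w : free_group X) n :
  w != 1%g -> (n <= size (word (w ^+ n)%g))%N.
Proof.
move=> w1; have w0 : word w != [::] by [].
have [u [c [wE c0 rc]]] := cyclic_decomposition (wordP w) w0.
pose pw m := iter m (cat c) (winv u).
have rw := wordP w; rewrite wE in rw.
have rpw m : reduced (c ++ pw m).
  by elim: m => [|m IH]; [exact: reduced_catr rw|exact: reduced_glue].
have rupw m : reduced (u ++ pw m.+1).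
  apply: reduced_glue => //; apply: reduced_catl (winv u) _.
  by rewrite -catA.
have wordX m : word (w ^+ m.+1)%g = u ++ pw m.+1.
  elim: m => [|m IH]; first by rewrite expg1 wE.
  rewrite expgS -[LHS]/(wmul (word w) (word (w ^+ m.+1)%g)) IH wE !wmul_catl.
  rewrite -[X in wmul (winv u) X]wmul_cat_reduced// wmulVK; last exact: rpw.
  by rewrite (wmul_cat_reduced (rpw m.+1)) (wmul_cat_reduced (rupw m.+1)).
case: n => // n; rewrite wordX size_cat; apply: leq_trans (leq_addl _ _).
elim: n.+1 => // m IH; rewrite /= size_cat -add1n leq_add//.
by case: (c) c0.
Qed.

(** If [r] is a [p ^ k]-th power, then [k] is at most [p ^ k], hence at most the length of [r]. *)
Lemma nu_exists p (r : free_group X) :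
  (1 < p)%N -> r != 1%g -> exists k, is_nu p r k.
Proof.
move=> p1 r1.
pose P k := `[< exists w : free_group X, (w ^+ (p ^ k)%N)%g = r >].
have P0 : exists k, P k by exists 0%N; apply/asboolP; exists r; rewrite expn0 expg1.
have Pbound k : P k -> (k <= size (word r))%N.
  move=> /asboolP[w wr]; have w1 : w != 1%g.
    by apply: contra_neq r1 => w1; rewrite -wr w1 expg1n.
  rewrite -wr; apply: leq_trans (leq_size_expg _ w1).
  exact/ltnW/ltn_expl.
exists (ex_maxn P0 Pbound); case: ex_maxnP => k /asboolP Pk kmax.
by split=> // j Pj; apply: kmax; apply/asboolP.
Qed.

End FreeGroupRoots.

(** * Cocycles on finite quotients of free groups *)

Section PathSums.
Local Open Scope group_scope.
Variables (X : choiceType) (G : groupType) (f : X -> G).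
Implicit Types (g h : free_group X).

Lemma fg_liftX g n : fg_lift f (g ^+ n) = fg_lift f g ^+ n.
Proof. by elim: n => [|n IH]; rewrite ?expg0// !expgS fg_lift_mul IH. Qed.

Lemma letter_valV a : letter_val f (inv_letter a) = (letter_val f a)^-1.
Proof. by case: a => x []; rewrite /letter_val /= ?invgK. Qed.

Variables (A : zmodType) (b : X -> G -> A).

(* [b x u] is the weight of the edge from [u] to [u * f x] in the Cayley      *)
(* graph of [G].                                                              *)
Definition edge_weight (a : X * bool) (u : G) : A :=
  (if a.2 then b a.1 u else - b a.1 (u * (f a.1)^-1))%R.

Fixpoint path_sum (s : seq (X * bool)) (u : G) : A :=
  (if s is a :: s' then edge_weight a u + path_sum s' (u * letter_val f a)
   else 0)%R.

Definition cocycle (g : free_group X) (u : G) : A := path_sum (word g) u.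

Lemma edge_weightV a u :
  (edge_weight a u + edge_weight (inv_letter a) (u * letter_val f a))%R = 0%R.
Proof.
case: a => x []; rewrite /edge_weight /letter_val /=.
  by rewrite mulgK subrr.
by rewrite addNr.
Qed.

(** The path of a product is the concatenation of the paths up to cancellation, and an edge followed
    by its reverse contributes zero. *)
Lemma cocycleM g h u :
  cocycle (g * h) u = (cocycle g u + cocycle h (u * fg_lift f g))%R.
Proof.
rewrite /cocycle /fg_lift; case: g h => [s rs] [t rt] /= {rs rt}.
elim: s u => [|a s IH] u /=; first by rewrite add0r mulg1.
rewrite -addrA mulgA -IH; case: (wmul s t) => //= c v.
case: eqP => //= ->.
by rewrite addrA edge_weightV add0r letter_valV mulgK.
Qed.

Lemma cocycle1 u : cocycle 1 u = 0%R.
Proof. by []. Qed.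

Lemma cocycle_gen x u : cocycle (fg_gen x) u = b x u.
Proof. by rewrite /cocycle /= addr0. Qed.

Lemma cocycleV g u : cocycle g^-1 u = (- cocycle g (u * (fg_lift f g)^-1))%R.
Proof.
have lV : fg_lift f g^-1 = (fg_lift f g)^-1.
  by apply: (mulgI (fg_lift f g)); rewrite -fg_lift_mul !mulgV.
apply/eqP; rewrite -addr_eq0 -lV -cocycleM mulVg.
by rewrite cocycle1.
Qed.

Lemma cocycleX g n u :
  cocycle (g ^+ n) u = (\sum_(i < n) cocycle g (u * fg_lift f g ^+ i))%R.
Proof.
elim: n u => [|n IH] u; first by rewrite big_ord0.
rewrite expgS cocycleM IH big_ord_recl expg0 mulg1; congr (_ + _)%R.
by apply: eq_bigr => i _; rewrite /= expgS mulgA.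
Qed.

(** Here [g ^+ n] traces a closed loop, which is run through [m] times. *)
Lemma cocycleXM g n m u : fg_lift f (g ^+ n) = 1 ->
  cocycle (g ^+ (n * m)%N) u = (cocycle (g ^+ n)%g u *+ m)%R.
Proof.
move=> gn1; rewrite expgnA [LHS]cocycleX; under eq_bigr do rewrite gn1 expg1n mulg1.
by rewrite sumr_const card_ord.
Qed.

(** Since [g] commutes with [g ^+ n], the value is constant on left cosets of the cyclic group
    generated by the image of [g]; one equation per coset will suffice. *)
Lemma cocycleX_mulr g n u : fg_lift f (g ^+ n) = 1 ->
  cocycle (g ^+ n) (u * fg_lift f g) = cocycle (g ^+ n) u.
Proof.
move=> gn1; have := cocycleM g (g ^+ n) u.
by rewrite -expgS expgSr cocycleM gn1 mulg1 addrC => /addrI.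
Qed.

End PathSums.

Section CocycleLinear.
Local Open Scope ring_scope.
Variables (X : choiceType) (G : groupType) (f : X -> G).
Implicit Types (g h : free_group X).

Lemma cocycle_additive (A B : zmodType) (phi : {additive A -> B}) b g u :
  phi (cocycle f b g u) = cocycle f (fun x v => phi (b x v)) g u.
Proof.
rewrite /cocycle; elim: (word g) u => [|a s IH] u /=; first by rewrite raddf0.
rewrite raddfD IH /edge_weight; case: (a.2) => //.
by rewrite raddfN.
Qed.

Lemma cocycle_linear (R : nzRingType) (c : R) b b' g u :
  cocycle f (fun x v => c * b x v + b' x v) g u =
  c * cocycle f b g u + cocycle f b' g u.
Proof.
rewrite /cocycle; elim: (word g) u => [|a s IH] u /=.
  by rewrite mulr0 addr0.
rewrite IH mulrDr addrACA; congr (_ + _); rewrite /edge_weight; case: (a.2) => //.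
by rewrite opprD mulrN.
Qed.

End CocycleLinear.

Section SkewProduct.
Local Open Scope group_scope.
Variables (X : choiceType) (gT : finGroupType) (A : finZmodType).
Variables (f : X -> gT) (b : X -> gT -> A).

(** The covering of the Cayley graph of [gT] with fibre [A] and edge weights [b]. Permutations of
    its vertices realize the extension as a finite group. *)
Definition skew_fun x (y : gT * A) : gT * A := (y.1 * f x, (y.2 + b x y.1)%R).

Lemma skew_fun_inj x : injective (skew_fun x).
Proof. by move=> [u c] [v d] [] /mulIg <- /addIr <-. Qed.

Definition skew_product x : {perm gT * A} := perm (@skew_fun_inj x).

Lemma skew_productE g u c : fg_lift skew_product g (u, c) =
  (u * fg_lift f g, (c + cocycle f b g u)%R).
Proof.
rewrite /cocycle /fg_lift; elim: (word g) u c => [|a s IH] u c /=.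
  by rewrite perm1 mulg1 addr0.
rewrite permM; have -> : letter_val skew_product a (u, c) =
    (u * letter_val f a, (c + edge_weight f b a u)%R).
  rewrite /letter_val /edge_weight; case: (a.2); first by rewrite permE.
  by apply: (canLR (permK _)); rewrite permE /skew_fun /= mulgKV subrK.
by rewrite IH mulgA addrA.
Qed.

Lemma skew_product_eq1 g : fg_lift skew_product g = 1 <->
  fg_lift f g = 1 /\ forall u, cocycle f b g u = 0%R.
Proof.
split=> [g1|[g1 gb]]; last first.
  by apply/permP => -[u c]; rewrite skew_productE g1 gb perm1 mulg1 addr0.
have E u : (u, 0%R) = (u * fg_lift f g, cocycle f b g u).
  by rewrite -[cocycle _ _ _ _]add0r -skew_productE g1 perm1.
split=> [|u]; last by case: (E u).
by case: (E 1) => /esym; rewrite mul1g.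
Qed.

End SkewProduct.

(** * Homogeneous linear systems and divisibility *)

Section LinearSystems.
Local Open Scope ring_scope.

Lemma homogeneous_system (F : fieldType) n (J : eqType) (s : seq J)
    (L : J -> 'rV[F]_n -> F) :
  (forall j a u v, L j (a *: u + v) = a * L j u + L j v) ->
  (size s < n)%N -> exists2 v, v != 0 & forall j, j \in s -> L j v = 0.
Proof.
move=> linL sn.
pose M := \matrix_(i < n, j < size s) L (tnth (in_tuple s) j) (delta_mx 0 i).
have kerM : kermx M != 0.
  rewrite kermx_eq0 /row_free; apply: contraTneq sn => rM.
  by rewrite -leqNgt -[n in (n <= _)%N]rM rank_leq_col.
exists (nz_row (kermx M)); first by rewrite nz_row_eq0.
have vM : nz_row (kermx M) *m M = 0 by apply/sub_kermxP/nz_row_sub.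
set v := nz_row _ in vM *; move=> j /(nthP j)[i is_s <-].
have L0 k : L k 0 = 0 by have := linL k (-1) 0 0; rewrite scaler0 addr0 mulN1r addNr.
have := congr1 (fun N : 'rV_(size s) => N 0 (Ordinal is_s)) vM; rewrite !mxE => <-.
rewrite {1}(row_sum_delta v) (big_morph (L _) (id1 := 0) (op1 := +%R)) //; last first.
  by move=> x y; rewrite -[x]scale1r linL mul1r scale1r.
apply: eq_bigr => k _; rewrite mxE (tnth_nth j) /= -[in LHS](addr0 (_ *: _)) linL.
by rewrite L0 addr0.
Qed.

Lemma homogeneous_int_system (I : finType) (J : eqType) (s : seq J)
    (L : J -> (I -> rat) -> rat) :
  (forall j c u v, L j (fun i => c * u i + v i) = c * L j u + L j v) ->
  (size s < #|I|)%N ->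
  exists z : I -> int, (exists i, z i != 0) /\
    forall j, j \in s -> L j (fun i => (z i)%:~R) = 0.
Proof.
move=> linL sI.
pose L' j (v : 'rV[rat]_#|I|) := L j (fun i => v 0 (enum_rank i)).
have [|v v0 Lv] := @homogeneous_system _ _ _ s L' _ sI.
  move=> j a u v; rewrite /L' -linL; congr (L j _).
  by apply/funext => i; rewrite !mxE.
pose q i := v 0 (enum_rank i); pose d := \prod_i denq (q i).
have d0 : d != 0 by apply/prodf_neq0 => i _; apply: denq_neq0.
(* This is the integer [d * q i], with [d] a common denominator. *)
pose z i := numq (q i) * \prod_(j | j != i) denq (q j).
have zE i : (z i)%:~R = d%:~R * q i.
  rewrite /z /d [in RHS](bigD1 i)//= !intrM.
  have := divq_num_den (q i); have := denq_neq0 (q i); rewrite -(@intr_eq0 rat).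
  by move: (numq (q i)) (denq (q i)) => a b b0 <-; field.
exists z; split.
  have [k vk] : exists k, v 0 k != 0.
    apply/existsP; apply: contra_neqT v0 => /existsPn v0.
    by apply/rowP => k; rewrite mxE; apply/eqP; have := v0 k; rewrite negbK.
  exists (enum_val k); rewrite -(@intr_eq0 rat) zE mulf_neq0 ?intr_eq0//.
  by rewrite /q enum_valK.
move=> j js; have L0 : L j (fun=> 0) = 0.
  have := linL j (-1) (fun=> 0) (fun=> 0); rewrite [in RHS]mulN1r addNr => {2}<-.
  by congr (L j _); apply/funext => i; rewrite mulr0 addr0.
transitivity (L j (fun i => d%:~R * q i + 0)).
  by congr (L j _); apply/funext => i; rewrite zE addr0.
by rewrite linL L0 addr0 [L j _]Lv ?mulr0.
Qed.

End LinearSystems.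

(** Turns maximality of the sum of the orders into equality of each order. *)
Lemma eq_leq_sum (T : eqType) (s : seq T) (E1 E2 : T -> nat) :
  (forall x, x \in s -> E1 x <= E2 x)%N ->
  (\sum_(x <- s) E2 x <= \sum_(x <- s) E1 x)%N ->
  forall x, x \in s -> E1 x = E2 x.
Proof.
move=> le12 sum21 x xs; apply/eqP; rewrite eqn_leq le12//= leqNgt.
apply: contraTN sum21 => lt12; rewrite -ltnNge.
rewrite (big_rem x)//= [ltnRHS](big_rem x)//= -addSn leq_add//.
rewrite big_seq [leqRHS]big_seq leq_sum// => y /mem_rem; exact: le12.
Qed.

Lemma dvdz_expn_eq0 (p : nat) (z : int) :
  (1 < p)%N -> (forall t, (Posz (p ^ t) %| z)%Z) -> z = 0%R.
Proof.
move=> p1 pz; apply/eqP; rewrite -absz_eq0; apply: contraTT (pz `|z|%N).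
rewrite -lt0n dvdzE /= => z0; rewrite gtnNdvd//.
exact: ltn_expl.
Qed.

Lemma intr_Zp_eq0 (q : nat) (z : int) :
  (1 < q)%N -> ((z%:~R : 'Z_q) == 0)%R = (Posz q %| z)%Z.
Proof.
move=> q1; have natE n : ((n%:R : 'Z_q) == 0)%R = (q %| n)%N.
  by rewrite -val_eqE /= val_Zp_nat.
by case: z => n; rewrite dvdzE ?NegzE ?mulrNz ?oppr_eq0 -pmulrn natE //= ?abszN.
Qed.

(** * Harmonic cocycles killing finitely many relators *)

Section FiniteStage.
Variables (X : finType) (p : nat).
Hypothesis p_prime : prime p.
(* The pair [(w, m)] stands for the relator [w ^+ (p ^ m)].                   *)
Variable S : seq (free_group X * nat).

Definition relator (x : free_group X * nat) : free_group X :=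
  (x.1 ^+ (p ^ x.2)%N)%g.

Definition finite_quotient (gT : finGroupType) (f : X -> gT) :=
  forall x, x \in S -> fg_lift f (relator x) = 1%g.

Definition order_sum (gT : finGroupType) (f : X -> gT) :=
  (\sum_(x <- S) #[fg_lift f x.1]%g)%N.

Lemma order_dvd (gT : finGroupType) (f : X -> gT) x :
  finite_quotient f -> x \in S -> (#[fg_lift f x.1]%g %| p ^ x.2)%N.
Proof. by move=> fS xS; rewrite order_dvdn -fg_liftX; apply/eqP/fS. Qed.

(** Each order divides [p ^ x.2], which bounds [order_sum]; the trivial quotient provides a first
    value. *)
Lemma maximal_finite_quotient : exists (gT : finGroupType) (f : X -> gT),
  finite_quotient f /\ forall (gT' : finGroupType) (f' : X -> gT'),
    finite_quotient f' -> (order_sum f' <= order_sum f)%N.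
Proof.
pose P n := `[< exists (gT : finGroupType) (f : X -> gT),
  finite_quotient f /\ order_sum f = n >].
have P0 : exists n, P n.
  exists (order_sum (fun _ : X => 1%g : {perm bool})); apply/asboolP.
  exists {perm bool}, (fun=> 1%g); split=> // x _.
  rewrite /fg_lift; elim: (word _) => //= a s ->; rewrite mulg1 /letter_val.
  by case: (a.2); rewrite ?invg1.
have Pbound n : P n -> (n <= \sum_(x <- S) p ^ x.2)%N.
  move=> /asboolP[gT [f [fS <-]]]; rewrite /order_sum big_seq [leqRHS]big_seq.
  apply: leq_sum => x xS; apply: dvdn_leq; last exact: order_dvd.
  by rewrite expn_gt0 prime_gt0.
case: (ex_maxnP P0 Pbound) => n /asboolP[gT [f [fS fn]]] nmax.
exists gT, f; split=> // gT' f' f'S; rewrite fn; apply: nmax; apply/asboolP.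
by exists gT', f'.
Qed.

Section Descent.
Local Open Scope group_scope.
Variables (gT : finGroupType) (f : X -> gT).
Hypothesis fS : finite_quotient f.
Hypothesis fmax : forall (gT' : finGroupType) (f' : X -> gT'),
  finite_quotient f' -> (order_sum f' <= order_sum f)%N.

Definition full_order x := #[fg_lift f x.1] == (p ^ x.2)%N.

Lemma cocycle_relator (A : zmodType) (b : X -> gT -> A) x u : x \in S ->
  cocycle f b (relator x) u =
  (cocycle f b (x.1 ^+ #[fg_lift f x.1])%g u *+ (p ^ x.2 %/ #[fg_lift f x.1]))%R.
Proof.
move=> xS; rewrite -cocycleXM; last by rewrite fg_liftX expg_order.
by rewrite mulnC divnK// order_dvd.
Qed.

(** The skew product is again a finite quotient, in which the orders are multiples of those in [gT].
    By maximality they are equal, so this power is trivial there too. *)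
Lemma skew_order (A : finZmodType) (b : X -> gT -> A) x u :
  (forall y v, y \in S -> cocycle f b (relator y) v = 0%R) -> x \in S ->
  cocycle f b (x.1 ^+ #[fg_lift f x.1]) u = 0%R.
Proof.
move=> bS xS; have f'S : finite_quotient (skew_product f b).
  by move=> y yS; apply/skew_product_eq1; split; [exact: fS|move=> v; exact: bS].
suff E : #[fg_lift f x.1] = #[fg_lift (skew_product f b) x.1].
  have : fg_lift (skew_product f b) (x.1 ^+ #[fg_lift f x.1]) = 1.
    by rewrite E fg_liftX expg_order.
  by move=> /skew_product_eq1[_]; apply.
apply: (eq_leq_sum _ (fmax f'S) xS) => y yS; apply: dvdn_leq; first exact: order_gt0.
rewrite order_dvdn -fg_liftX; apply/eqP.
have : fg_lift (skew_product f b) (y.1 ^+ #[fg_lift (skew_product f b) y.1]) = 1.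
  by rewrite fg_liftX expg_order.
by move=> /skew_product_eq1[].
Qed.

(* relators modulo [p ^ t.+1]; the resulting larger finite quotient does not  *)
(* increase the order of [x.1], so the values are divisible by [p ^ t.+1].    *)
Lemma cocycle_descent (b : X -> gT -> int) :
  (forall x u, x \in S -> full_order x -> cocycle f b (relator x) u = 0%R) ->
  forall x u, x \in S -> cocycle f b (relator x) u = 0%R.
Proof.
move=> bgood x u xS; rewrite cocycle_relator//.
(* As the integers are torsion-free, it remains to show that the value at the power of [x.1] is
   zero, i.e. divisible by every [p ^ t]. *)
apply/eqP; rewrite mulrn_eq0; apply/orP; right; apply/eqP.
apply: (dvdz_expn_eq0 (prime_gt1 p_prime)) => t.
elim: t x u xS => [|t IH] x u xS; first by rewrite expn0 dvd1z.
(* ['Z_q] is the ring of integers modulo [q] only for [1 < q]. *)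
have q1 : (1 < p ^ t.+1)%N by rewrite -(exp1n t.+1) ltn_exp2r// prime_gt1.
have cocycle_mod g v : cocycle f (fun y v => (b y v)%:~R : 'Z_(p ^ t.+1))%R g v =
    ((cocycle f b g v)%:~R)%R.
  by rewrite (cocycle_additive _ (intmul (1 : 'Z_(p ^ t.+1))%R)).
rewrite -(intr_Zp_eq0 _ q1) -cocycle_mod; apply/eqP; apply: skew_order => // y v yS.
apply/eqP; rewrite cocycle_mod intr_Zp_eq0//.
have [yfull|ynfull] := boolP (full_order y); first by rewrite bgood// dvdz0.
rewrite cocycle_relator// -mulr_natl -[X in (X %| _)%Z]natz expnS natrM.
rewrite !natz dvdz_mul ?IH// dvdzE /=.
(* The order is [p ^ j] with [j < y.2], so the multiplicity supplies the factor [p] missing from the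
   induction hypothesis. *)
have /(dvdn_pfactor _ _ p_prime)[j jm E] := order_dvd fS yS.
rewrite /full_order E in ynfull *; rewrite -expnB ?prime_gt0//.
have : (j < y.2)%N by rewrite ltn_neqAle jm andbT; apply: contraNneq ynfull => ->.
by rewrite -subn_gt0; case: (y.2 - j)%N => // d _; rewrite expnS dvdn_mulr.
Qed.

End Descent.

Lemma lcoset_representatives (gT : finGroupType) (H : {group gT}) :
  exists s : seq gT, (size s * #|H| = #|gT|)%N /\
    forall u, exists2 v, v \in s & exists2 h, h \in H & u = (v * h)%g.
Proof.
exists [seq repr C | C : {set gT} in lcosets H (finset.setTfor gT)]; split.
  rewrite size_map -cardE card_lcosets mulnC -cardsT.
  by apply: Lagrange; apply: finset.subsetT.
move=> u; exists (repr (u *: H)%g).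
  by apply/mapP; exists (u *: H)%g => //; rewrite mem_enum; apply/lcosetsP; exists u.
have : repr (u *: H)%g \in (u *: H)%g by apply: (mem_repr u); rewrite lcoset_refl.
case/lcosetP => h hH ->; exists h^-1%g; first by rewrite groupV.
by rewrite mulgK.
Qed.

Lemma finite_cocycle (K : numFieldType) :
  (1 + \sum_(x <- S) p%:R ^- x.2 < #|X|%:R :> K)%R ->
  exists (gT : finGroupType) (f : X -> gT) (b : X -> gT -> int),
    [/\ exists x u, b x u != 0%R,
        forall u, (\sum_x (b x (u * (f x)^-1)%g - b x u))%R = 0%R &
        forall x, x \in S -> fg_lift f (relator x) = 1%g /\
          forall u, cocycle f b (relator x) u = 0%R].
Proof.
move=> defS; have [gT [f [fS fmax]]] := maximal_finite_quotient.
pose H (x : free_group X * nat) := <[fg_lift f x.1]>%G.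
have [reps repsP] := choice (fun x => lcoset_representatives (H x)).
pose T := [seq x <- S | full_order f x].
pose J : eqType := (option (free_group X * nat) * gT)%type.
(* [None] labels the harmonicity equations, one per element of [gT]; [Some x] labels the vanishing
   on a relator of full order, one equation per coset. *)
pose s : seq J := [seq (None, u) | u <- enum gT] ++
  [seq (Some x, u) | x <- T, u <- reps x].
pose L (j : J) (v : X * gT -> rat) : rat := (if j.1 is Some x
  then cocycle f (fun y u => v (y, u)) (relator x) j.2
  else \sum_y (v (y, (j.2 * (f y)^-1)%g) - v (y, j.2)))%R.
have linL j c u v : (L j (fun i => c * u i + v i) = c * L j u + L j v)%R.
  rewrite /L; case: j.1 => [x|]; first by rewrite -cocycle_linear.
  by rewrite mulr_sumr -big_split; apply: eq_bigr => y _ /=; ring.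
have size_s : (size s < #|{: X * gT}|)%N.
  rewrite card_prod size_cat size_map -cardE size_allpairs_dep.
  rewrite -(ltr_nat K) natrM natrD sumnE big_map big_filter natr_sum.
  have gT0 : (0 < #|gT|%:R :> K)%R by rewrite ltr0n; apply/card_gt0P; exists 1%g.
  apply: (@le_lt_trans _ _ ((1 + \sum_(x <- S) p%:R ^- x.2) * #|gT|%:R)%R); last first.
    by rewrite ltr_pM2r.
  rewrite mulrDl mul1r lerD2l mulr_suml big_mkcond/=.
  apply: ler_sum => x _; case: ifPn => [/eqP xfull|_]; last first.
    by rewrite mulr_ge0// ?ler0n// invr_ge0 exprn_ge0.
  have [<- _] := repsP x; rewrite -orderE xfull natrM natrX mulrCA mulVf ?mulr1//.
  by rewrite expf_neq0// pnatr_eq0 -lt0n prime_gt0.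
have [z [[[x u] zxu] Lz]] := homogeneous_int_system linL size_s.
exists gT, f, (fun y v => z (y, v)).
have intr_cocycle g v : cocycle f (fun y w => (z (y, w))%:~R : rat)%R g v =
    ((cocycle f (fun y w => z (y, w)) g v)%:~R)%R.
  by rewrite (cocycle_additive _ (intmul (1 : rat))%R).
split; first by exists x, u.
  move=> v; apply/eqP; rewrite -(@intr_eq0 rat); apply/eqP.
  rewrite rmorph_sum -[RHS](Lz (None, v)).
    by apply: eq_bigr => y _; rewrite rmorphB.
  by rewrite mem_cat map_f// mem_enum.
move=> y yS; split; first exact: fS.
move=> v; apply: cocycle_descent => // {v yS}y v yS yfull.
have [w wr [h]] := (repsP y).2 v.
case/cycleP => i -> ->; apply/eqP; rewrite -(@intr_eq0 rat) -intr_cocycle; apply/eqP.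
rewrite -[RHS](Lz (Some y, w)); last first.
  rewrite mem_cat; apply/orP; right; apply/allpairsPdep; exists y, w.
  by rewrite mem_filter yfull.
(* The equation at the representative [w] spreads over its coset. *)
elim: i => [|i IH]; first by rewrite expg0 mulg1.
by rewrite expgSr mulgA /relator cocycleX_mulr ?IH//; apply: fS.
Qed.

End FiniteStage.

(** * Limits of harmonic kernels *)

Section FiniteKernel.
Local Open Scope ring_scope.
Variables (K : realType) (X : finType).
Implicit Types (g h r : free_group X).

(** The first argument suffices: harmonic kernels are symmetric. *)
Definition kills (k : free_group X -> free_group X -> K) r :=
  forall g h x, k (g * r * h)%g x = k (g * h)%g x.

Lemma finite_kernel p (S : seq (free_group X * nat)) : prime p ->
  1 + \sum_(x <- S) p%:R ^- x.2 < #|X|%:R :> K ->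
  exists k, harmonic_kernel (@fg_gen X) k /\
    forall x, x \in S -> kills k (relator p x).
Proof.
move=> pp defS; have [gT [f [b [[x0 [u0 b0]] bdiv bS]]]] := finite_cocycle pp defS.
pose c g u : K := (cocycle f b g u)%:~R.
(* The total squared norm of the values at the generators, used to normalize the kernel. *)
pose n : K := \sum_x \sum_u (b x u)%:~R ^+ 2.
have n0 : 0 < n.
  rewrite /n (bigD1 x0)//= (bigD1 u0)//= -addrA ltr_pwDl//.
    by rewrite exprn_even_gt0//= intr_eq0.
  rewrite addr_ge0// sumr_ge0// => *; last rewrite sumr_ge0// => *; exact: sqr_ge0.
have cM g h u : c (g * h)%g u = c g u + c h (u * fg_lift f g)%g.
  by rewrite /c cocycleM rmorphD.
exists (fun g h => n^-1 * \sum_u c g u * c h u); split; last first.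
  move=> r rS g h x; have [r1 rb] := bS r rS; congr (_ * _).
  apply: eq_bigr => u _; congr (_ * _).
  by rewrite !cM fg_lift_mul r1 mulg1 {2}/c rb addr0.
split.
- move=> t; have -> : comb_form (fun g h => n^-1 * \sum_u c g u * c h u) t t =
      n^-1 * \sum_u (\sum_(x <- t) x.1 * c x.2 u) ^+ 2.
    transitivity (\sum_(x <- t) \sum_u \sum_(y <- t)
        n^-1 * (x.1 * c x.2 u * (y.1 * c y.2 u))).
      apply: eq_bigr => x _; rewrite exchange_big; apply: eq_bigr => y _ /=.
      by rewrite !mulr_sumr; apply: eq_bigr => u _; ring.
    rewrite exchange_big mulr_sumr; apply: eq_bigr => u _ /=.
    rewrite expr2 mulr_suml mulr_sumr; apply: eq_bigr => x _.
    by rewrite !mulr_sumr.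
  by rewrite mulr_ge0 ?invr_ge0 ?(ltW n0)// sumr_ge0// => u _; apply: sqr_ge0.
- by move=> g h; congr (_ * _); apply: eq_bigr => u _; rewrite mulrC.
- by move=> h; rewrite big1 ?mulr0// => u _; rewrite /c cocycle1 mul0r.
- move=> g h h'; rewrite -!mulrBr -mulrDr -!sumrB -big_split; congr (_ * _).
  (* Right translation of functions on [gT] is the orthogonal representation. *)
  rewrite [RHS](reindex_inj (mulIg (fg_lift f g)))/=.
  by apply: eq_bigr => u _; rewrite !cM; ring.
- rewrite -mulr_sumr -[RHS](mulVf (lt0r_neq0 n0)); congr (_ * _).
  by apply: eq_bigr => x _; apply: eq_bigr => u _; rewrite /c cocycle_gen expr2.
move=> h; under eq_bigr do rewrite -mulrDr -big_split /=.
rewrite -mulr_sumr exchange_big big1 ?mulr0// => u _.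
under eq_bigr do rewrite -mulrDl.
(* Up to sign, this factor is the inflow minus the outflow of [b] at [u]. *)
rewrite -mulr_suml [X in X * _](_ : _ = - (\sum_x (b x (u * (f x)^-1)%g - b x u))%:~R).
  by rewrite bdiv oppr0 mul0r.
rewrite -rmorphN -sumrN rmorph_sum; apply: eq_bigr => x _.
by rewrite /c cocycleV !cocycle_gen fg_lift_gen -rmorphD opprB.
Qed.

End FiniteKernel.

(** * Pointwise compactness of harmonic kernels *)

Section KernelLimit.
Local Open Scope ring_scope.
Variables (K : realType) (X : finType).
Implicit Types (g h r : free_group X).
Local Notation kernel := (free_group X -> free_group X -> K).
Local Notation harmonic := (harmonic_kernel (@fg_gen X)).

Lemma free_group_ind (P : free_group X -> Prop) : P 1%g ->
  (forall x g, P g -> P (fg_gen x * g)%g) ->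
  (forall x g, P g -> P ((fg_gen x)^-1 * g)%g) -> forall g, P g.
Proof.
move=> P1 Pgen PgenV [s]; elim: s => [|[x e] s IH] rs.
  by have -> : FreeGroup rs = 1%g by apply: val_inj.
have -> : FreeGroup rs = ((if e then fg_gen x else (fg_gen x)^-1) *
    FreeGroup (reduced_behead rs))%g.
  by apply: val_inj; case: e rs => rs /=; rewrite push_cons.
by case: e {rs} (reduced_behead rs) => rs; [apply: Pgen|apply: PgenV].
Qed.

Lemma harmonic_kernel_ge0 (k : kernel) g : harmonic k -> 0 <= k g g.
Proof.
by move=> kH; have := hk_psd kH [:: (1, g)]; rewrite /comb_form !big_seq1 !mul1r.
Qed.

Lemma harmonic_kernel_offdiag (k : kernel) g h : harmonic k ->
  `|k g h| <= k g g + k h h.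
Proof.
move=> kH; have := hk_psd kH [:: (1, g); (1, h)].
have := hk_psd kH [:: (1, g); (-1, h)].
rewrite /comb_form !big_cons !big_nil /= (hk_sym kH h g).
have := harmonic_kernel_ge0 g kH; have := harmonic_kernel_ge0 h kH.
by rewrite ler_norml => *; apply/andP; split; lra.
Qed.

Lemma harmonic_kernel_mul (k : kernel) g h : harmonic k ->
  k (g * h)%g (g * h)%g <= (k g g + k h h) *+ 2.
Proof.
(* The vector [b (g * h) - 2 b g] equals [pi g (b h) - b g]. *)
move=> kH; have := hk_psd kH [:: (1, (g * h)%g); (- 2, g)].
rewrite /comb_form !big_cons !big_nil /= (hk_sym kH g).
by have := hk_cocycle kH g h h; rewrite (hk_sym kH g); lra.
Qed.

Lemma harmonic_kernel_gen (k : kernel) x : harmonic k ->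
  k (fg_gen x) (fg_gen x) <= 1.
Proof.
move=> kH; rewrite -(hk_norm kH) (bigD1 x)//= lerDl sumr_ge0// => y _.
exact: harmonic_kernel_ge0.
Qed.

Lemma harmonic_kernel_genV (k : kernel) x : harmonic k ->
  k (fg_gen x)^-1%g (fg_gen x)^-1%g <= 1.
Proof.
move=> kH; have := hk_cocycle kH (fg_gen x) (fg_gen x)^-1%g (fg_gen x)^-1%g.
rewrite mulgV (hk_sym kH (fg_gen x)) !(hk_1 kH) => <-.
by have := harmonic_kernel_gen x kH; lra.
Qed.

(** The normalization bounds the generators and their inverses, and [harmonic_kernel_mul] extends
    the bound along words, uniformly in [k]. *)
Lemma harmonic_kernel_bounded g :
  exists C : K, forall k, harmonic k -> k g g <= C.
Proof.
elim/free_group_ind: g => [|x g [C kC]|x g [C kC]].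
- by exists 0 => k kH; rewrite (hk_1 kH).
- exists ((1 + C) *+ 2) => k kH; apply: (le_trans (harmonic_kernel_mul _ _ kH)).
  by rewrite lerMn2r/= lerD ?harmonic_kernel_gen ?kC.
- exists ((1 + C) *+ 2) => k kH; apply: (le_trans (harmonic_kernel_mul _ _ kH)).
  by rewrite lerMn2r/= lerD ?harmonic_kernel_genV ?kC.
Qed.

Lemma ultra_bounded_cvg (T : Type) (U : set_system T) (phi : T -> K) (C : K) :
  UltraFilter U -> (\forall t \near U, `|phi t| <= C) ->
  exists l : K, phi t @[t --> U] --> l.
Proof.
move=> UU phiC; have := @segment_compact K (- C) C.
move=> /(_ (phi @ U) _)[|l [_ lU]].
  by apply: filterS phiC => t /=; rewrite in_itv /= ler_norml.
exists l => B lB; have [//|UnB] := in_ultra_setVsetC (phi @^-1` B) UU.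
have [y [nBy By]] := lU (~` B) B UnB lB.
by [].
Qed.

Lemma cvg_bigsum (T I : Type) (U : set_system T) (s : seq I) (phi : I -> T -> K)
    (l : I -> K) : Filter U -> (forall i, phi i t @[t --> U] --> l i) ->
  \sum_(i <- s) phi i t @[t --> U] --> \sum_(i <- s) l i.
Proof.
move=> FU cphi; elim: s => [|i s IH].
  by rewrite big_nil; under eq_fun do rewrite big_nil; apply: cvg_cst.
by rewrite big_cons; under eq_fun do rewrite big_cons; apply: cvgD.
Qed.

Lemma cvg_eq_cst (T : Type) (U : set_system T) (phi : T -> K) (l c : K) :
  ProperFilter U -> phi t @[t --> U] --> l -> (\forall t \near U, phi t = c) ->
  l = c.
Proof.
move=> FU cphi phic; apply/eqP; rewrite eq_le; apply/andP; split.
  by apply: (cvgr_to_le cphi); apply: filterS phic => t ->.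
by apply: (cvgr_to_ge cphi); apply: filterS phic => t ->.
Qed.

(** An ultrafilter refining the filter of kernels that kill finite parts of [R] converges pointwise,
    by boundedness. Each condition is an equation or inequality in finitely many values, so it
    passes to the limit. *)
Lemma harmonic_kernel_compactness (R : set (free_group X)) :
  (forall S : seq (free_group X), (forall r, r \in S -> R r) ->
    exists k : kernel, harmonic k /\ forall r, r \in S -> kills k r) ->
  exists k : kernel, harmonic k /\ forall r, R r -> kills k r.
Proof.
move=> finR.
pose D := [set S : seq (free_group X) | forall r, r \in S -> R r].
pose B (S : seq (free_group X)) :=
  [set k : kernel | harmonic k /\ forall r, r \in S -> kills k r].
have FB : ProperFilter (filter_from D B).
  apply: filter_from_proper; last by move=> S /finR[k kH]; exists k.
  apply: filter_from_filter; first by exists [::].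
  move=> S S' SR S'R; exists (S ++ S').
    by move=> r; rewrite mem_cat => /orP[/SR|/S'R].
  move=> k [kH kS]; split; split=> // r rS; apply: kS; rewrite mem_cat rS ?orbT//.
have [U [UU sFU]] := ultraFilterLemma FB.
have UB S : D S -> U (B S) by move=> SD; apply: sFU; exists S.
have UH : \forall k \near U, harmonic k.
  by have : U (B [::]) by [apply: UB]; apply: filterS => k [].
have cvgU gh : exists l : K, (k : kernel) gh.1 gh.2 @[k --> U] --> l.
  have [C gC] := harmonic_kernel_bounded gh.1.
  have [C' hC] := harmonic_kernel_bounded gh.2.
  apply: (@ultra_bounded_cvg _ _ _ (C + C')).
  apply: filterS UH => k kH; apply: le_trans (harmonic_kernel_offdiag _ _ kH) _.
  by rewrite lerD ?gC ?hC.
have [l' cl'] := choice cvgU.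
pose l g h := l' (g, h).
have cl g h : (k : kernel) g h @[k --> U] --> l g h by apply: (cl' (g, h)).
have eqU phi a c : (phi (k : kernel) : K) @[k --> U] --> a ->
    (forall k, harmonic k -> phi k = c) -> a = c.
  by move=> /cvg_eq_cst ca phic; apply: ca; apply: filterS UH => k /phic.
exists l; split; last first.
  move=> r Rr g h x; apply/eqP; rewrite -subr_eq0; apply/eqP.
  apply: (@cvg_eq_cst _ U (fun k => k (g * r * h)%g x - k (g * h)%g x)).
    by apply: cvgB; apply: cl.
  have : U (B [:: r]) by apply: UB => r'; rewrite inE => /eqP ->.
  apply: filterS => k [_ kr] /=.
  have := kr r; rewrite mem_head => /(_ isT) kr'.
  by rewrite /= kr' subrr.
split.
- move=> t; have ct : comb_form (k : kernel) t t @[k --> U] --> comb_form l t t.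
    apply: cvg_bigsum => x; apply: cvg_bigsum => y.
    exact: cvgMl_tmp.
  by apply: (cvgr_to_ge ct); apply: filterS UH => k kH; apply: hk_psd kH t.
- move=> g h; apply/eqP; rewrite -subr_eq0; apply/eqP.
  apply: (eqU (fun k => k g h - k h g)); first exact: cvgB.
  by move=> k kH; rewrite (hk_sym kH) subrr.
- move=> h; apply: (eqU (fun k => k 1%g h)) => // k kH.
  exact: hk_1 kH h.
- move=> g h h'; apply/eqP; rewrite -subr_eq0; apply/eqP.
  apply: (eqU (fun k => k (g * h)%g (g * h')%g - k (g * h)%g g - k g (g * h')%g + k g g
     - k h h')).
    by apply: cvgB => //; apply: cvgD => //; apply: cvgB => //; apply: cvgB.
  by move=> k kH; rewrite (hk_cocycle kH) subrr.
- apply: (eqU (fun k => \sum_x k (fg_gen x) (fg_gen x))).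
    exact: cvg_bigsum.
  by move=> k kH; apply: hk_norm kH.
move=> h; apply: (eqU (fun k => \sum_x (k (fg_gen x) h + k (fg_gen x)^-1%g h))).
  by apply: cvg_bigsum => x; apply: cvgD.
by move=> k kH; apply: hk_harmonic kH h.
Qed.

End KernelLimit.

(** * Presentations of large deficiency *)

(** The killed elements form a normal subgroup, because they may be deleted anywhere in a
    product. *)
Lemma kills_normal_closure (K : realType) (X : finType) (R : set (free_group X))
    (k : free_group X -> free_group X -> K) :
  (forall r, R r -> kills k r) -> forall r, normal_closure R r -> kills k r.
Proof.
move=> kR r; apply; split=> //; split.
- by move=> g h x; rewrite mulg1.
- move=> r1 r2 k1 k2 g h x; rewrite mulgA -(k2 (g * r1 * r2^-1)%g h).
  by rewrite mulgVK k1.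
- move=> r1 u k1 g h x; rewrite /conjg !mulgA -[(_ * u * h)%g]mulgA k1.
  by rewrite mulgA mulgVK.
Qed.

Lemma harmonic_kernel_descends (K : realType) (X : finType) (G : groupType)
    (R : set (free_group X)) (phi : {multiplicative free_group X -> G})
    (k : free_group X -> free_group X -> K) :
  (forall y, exists g, phi g = y) ->
  [set g | phi g = 1%g] = normal_closure R ->
  harmonic_kernel (@fg_gen X) k -> (forall r, R r -> kills k r) ->
  exists k' : G -> G -> K, harmonic_kernel (fun x => phi (fg_gen x)) k'.
Proof.
move=> phi_surj phi_ker kH kR.
have kphi g g' h : phi g = phi g' -> k g h = k g' h.
  (* [g] is [g'] times an element of the kernel of [phi], which may be deleted. *)
  move=> gg'; have : kills k (g'^-1 * g)%g.
    apply: (kills_normal_closure kR); rewrite -phi_ker /=.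
    by apply: (mulgI (phi g')); rewrite -gmulfM mulVKg gg' mulg1.
  by move=> /(_ g' 1%g h); rewrite !mulg1 mulVKg.
have [lift liftK] := choice phi_surj.
pose k' y z := k (lift y) (lift z).
have kE g h : k' (phi g) (phi h) = k g h.
  rewrite /k' (kphi _ g) ?liftK// (hk_sym kH) (kphi _ h) ?liftK//.
  exact: hk_sym kH h g.
have phi1 : phi 1%g = 1%g by apply: (mulgI (phi 1%g)); rewrite -gmulfM !mulg1.
have phiV g : phi g^-1%g = (phi g)^-1%g.
  by apply: (mulgI (phi g)); rewrite -gmulfM !mulgV.
exists k'; split.
- move=> t; have -> : comb_form k' t t =
      comb_form k [seq (x.1, lift x.2) | x <- t] [seq (x.1, lift x.2) | x <- t].
    by rewrite /comb_form big_map; apply: eq_bigr => x _; rewrite big_map.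
  exact: hk_psd kH _.
- by move=> y z; apply: hk_sym kH _ _.
- by move=> y; rewrite -(liftK y) -phi1 kE (hk_1 kH).
- move=> y z z'; rewrite -(liftK y) -(liftK z) -(liftK z') -!gmulfM !kE.
  exact: hk_cocycle kH _ _ _.
- by under eq_bigr do rewrite kE; apply: hk_norm kH.
move=> y; rewrite -(liftK y).
by under eq_bigr do rewrite -phiV !kE; apply: hk_harmonic kH _.
Qed.

Section Deficiency.
Local Open Scope ring_scope.
Variables (K : realType) (p : nat) (X : finType).
Hypothesis p_prime : prime p.
Implicit Types (r : free_group X) (R : set (free_group X)).

Lemma relator_weightE r : r != 1%g ->
  exists x : free_group X * nat,
    relator p x = r /\ relator_weight K p r = p%:R ^- x.2.
Proof.
move=> r1; have [k0 rk0] := nu_exists (prime_gt1 p_prime) r1.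
have : [set Some k | k in is_nu p r] (nu p r).
  by apply: (xgetPex None); exists (Some k0), k0.
by case=> k [[w wr] _]; rewrite /relator_weight => <-; exists (w, k).
Qed.

Lemma relator_weight_gt0 r : r != 1%g -> 0 < relator_weight K p r.
Proof.
move=> /relator_weightE[x [_ ->]].
by rewrite invr_gt0 exprn_gt0// ltr0n prime_gt0.
Qed.

Lemma sum_le_esum R (S : seq (free_group X)) :
  uniq S -> (forall r, r \in S -> R r) ->
  ((\sum_(r <- S) relator_weight K p r)%:E <=
    esum R (fun r => (relator_weight K p r)%:E))%E.
Proof.
move=> Su SR; apply: esum_ge; exists [set` S].
  by split; [exact: finite_seq|move=> r /SR].
by rewrite -fsbig_seq// sumEFin.
Qed.

Lemma sum_weights_lt R (S : seq (free_group X)) :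
  (finite_set R /\ (1 < p_deficiency K p R)%E) \/
  (infinite_set R /\ (1 <= p_deficiency K p R)%E) ->
  uniq S -> (forall r, r \in S -> R r) ->
  1 + \sum_(r <- S) relator_weight K p r < #|X|%:R.
Proof.
move=> defR Su SR; have le_e := sum_le_esum Su SR.
rewrite /p_deficiency in defR.
case: defR => -[Rfin].
  (* An infinite sum would make the deficiency [-oo]. *)
  move: le_e; case: (esum _ _) => [e| |] //; rewrite lee_fin -EFinB lte_fin.
  by lra.
have [r [Rr rS1]] : exists r, R r /\ r \notin (1%g :: S).
  apply: contrapT => noR; apply: Rfin; apply: sub_finite_set (finite_seq (1%g :: S)).
  move=> r Rr /=; apply: contrapT => /negP rS; apply: noR.
  by exists r.
move: rS1; rewrite inE negb_or => /andP[r1 rS].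
have le_e' : ((\sum_(r <- r :: S) relator_weight K p r)%:E <=
    esum R (fun r => (relator_weight K p r)%:E))%E.
  apply: sum_le_esum; first by rewrite /= rS.
  by move=> r'; rewrite inE => /predU1P[->//|/SR].
move: le_e'; case: (esum _ _) => [e| |] //; rewrite lee_fin -EFinB lee_fin.
by rewrite big_cons; have := relator_weight_gt0 r1; lra.
Qed.

Lemma finite_relators_kernel R (S : seq (free_group X)) :
  (finite_set R /\ (1 < p_deficiency K p R)%E) \/
  (infinite_set R /\ (1 <= p_deficiency K p R)%E) ->
  (forall r, r \in S -> R r) ->
  exists k : free_group X -> free_group X -> K,
    harmonic_kernel (@fg_gen X) k /\ forall r, r \in S -> kills k r.
Proof.
(* Every kernel kills the trivial relator, which has no maximal root; repetitions are removed
   because [esum] counts each relator once. *)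
move=> defR SR; pose S' := undup [seq r <- S | r != 1%g].
have S'P r : r \in S' = (r != 1%g) && (r \in S) by rewrite mem_undup mem_filter.
have S'R r : r \in S' -> R r by rewrite S'P => /andP[_ /SR].
have rootE r : exists x : free_group X * nat, r != 1%g ->
    relator p x = r /\ relator_weight K p r = p%:R ^- x.2.
  have [->|/relator_weightE[x rx]] := eqVneq r 1%g; first by exists (1%g, 0).
  by exists x.
have [root rootP] := choice rootE.
have [|k [kH kS]] := @finite_kernel K X p [seq root r | r <- S'] p_prime.
  rewrite big_map; have := sum_weights_lt defR (undup_uniq _) S'R.
  congr (1 + _ < _); rewrite big_seq [RHS]big_seq; apply: eq_bigr => r.
  by rewrite S'P => /andP[/rootP[_ ->]].
exists k; split=> // r rS; have [->|r1] := eqVneq r 1%g.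
  by move=> g h x; rewrite mulg1.
have [<- _] := rootP r r1; apply/kS/map_f.
by rewrite S'P r1.
Qed.

End Deficiency.

Theorem corollary2p5 (K : realType) (p : nat) (X : finType)
    (R : set (free_group X)) (G : groupType) :
  prime p ->
  is_presentation R G ->
  (finite_set R /\ (1 < p_deficiency K p R)%E) \/
  (infinite_set R /\ (1 <= p_deficiency K p R)%E) ->
  ~ property_T K G.
Proof.
move=> p_prime [phi [phi_surj phi_ker]] defR.
have [k [kH kR]] := harmonic_kernel_compactness
  (fun S => finite_relators_kernel p_prime defR (S := S)).
have [k' k'H] := harmonic_kernel_descends phi_surj phi_ker kH kR.
exact: harmonic_kernel_not_T k'H.
Qed.
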